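(* There is a polynomial-time algorithm which, given a graph $G=(V,E)$, two distinct non-adjacent vertices $s,t\in V$, an integer $L>0$, and a rooted tree decomposition $T$ of $G$ of width $\tau$, outputs an $L$-bounded $s$-$t$ vertex cut $F$ of $G$ with $|F|\le \tau\cdot \mathrm{opt}$, where $\mathrm{opt}$ is the minimum cardinality of an $L$-bounded $s$-$t$ vertex cut of $G$.
   Context: The length of a path is its number of edges. Given a graph $G=(V,E)$, vertices $s,t\in V$ and an integer $L>0$, an $L$-bounded $s$-$t$ vertex cut is a set $F\subseteq V\setminus\{s,t\}$ such that every $s$-$t$ path in $G\setminus F$ has length more than $L$ (such a set exists whenever $s$ and $t$ are not adjacent). A tree decomposition of $G$ is a tree $T$ with a bag $B(a)\subseteq V$ for each node $a$, such that every vertex and every edge of $G$ is contained in some bag, and for each vertex $v$ the nodes whose bags contain $v$ form a connected subtree; its width is $\max_a |B(a)|-1$. A rooted tree decomposition is one whose tree is rooted. *)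

(* Defs.v *)
From mathcomp Require Import all_boot.

Set Implicit Arguments.
Unset Strict Implicit.
Unset Printing Implicit Defensive.

Definition simple_graph (V : finType) (e : rel V) : Prop :=
  symmetric e /\ irreflexive e.

Definition induced (V : finType) (S : {set V}) (e : rel V) : rel V :=
  [rel x y | [&& x \in S, y \in S & e x y]].

(* The vertex sequence of the path is s :: p, so its length, as a number of
   edges, is size p. *)
Definition st_path (V : finType) (e : rel V) (s t : V) (p : seq V) : Prop :=
  [/\ path e s p, last s p = t & uniq (s :: p)].

Definition bounded_cut (V : finType) (e : rel V) (s t : V) (L : nat)
    (F : {set V}) : Prop :=
  F \subset ~: [set s; t] /\
  forall p : seq V, st_path (induced (~: F) e) s t p -> L < size p.

Definition min_cut_card (V : finType) (e : rel V) (s t : V) (L k : nat) : Prop :=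
  (exists2 F : {set V}, bounded_cut e s t L F & #|F| = k) /\
  (forall F : {set V}, bounded_cut e s t L F -> k <= #|F|).

Definition tree (A : finType) (e : rel A) : Prop :=
  [/\ simple_graph e,
      forall a b : A, connect e a b
    & forall c : seq A, 2 < size c -> uniq c -> ~~ cycle e c].

Definition tree_decomposition (V : finType) (G : rel V)
    (A : finType) (T : rel A) (B : A -> {set V}) : Prop :=
  [/\ tree T,
      forall v : V, exists a : A, v \in B a,
      forall u v : V, G u v -> exists2 a : A, u \in B a & v \in B a
    & forall (v : V) (a b : A), v \in B a -> v \in B b ->
        connect (induced [set x | v \in B x] T) a b].

(* The truncated predecessor is harmless: a decomposition of a graph with at
   least one vertex has a nonempty bag. *)
Definition width (V A : finType) (B : A -> {set V}) : nat :=
  (\max_(a : A) #|B a|).-1.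

(* The model of computation is a random access machine running structured
   programs.  A state consists of registers, addressed by literals of the
   program, and of a memory of natural numbers, addressed by computed values.
   Addition and truncated subtraction are the only arithmetic operations, so
   that the bit length of the values grows by at most O(1) per unit of time and
   polynomial time here coincides with polynomial time on Turing machines. *)

Inductive expr : Type :=
  | Lit of nat
  | Reg of nat
  | Mem of expr
  | Add of expr & expr
  | Sub of expr & expr.

Inductive cmd : Type :=
  | Skip
  | Assign of nat & expr
  | Store of expr & expr
  | Seq of cmd & cmd
  | If of expr & cmd & cmd
  | While of expr & cmd.

Record state : Type := State { regs : nat -> nat; mem : nat -> nat }.

Definition update (f : nat -> nat) (i v : nat) : nat -> nat :=
  fun j => if j == i then v else f j.

Fixpoint eval (st : state) (e : expr) : nat :=
  match e with
  | Lit k => k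
  | Reg i => regs st i
  | Mem e1 => mem st (eval st e1)
  | Add e1 e2 => eval st e1 + eval st e2
  | Sub e1 e2 => eval st e1 - eval st e2
  end.

Fixpoint ecost (e : expr) : nat :=
  match e with
  | Lit _ | Reg _ => 1
  | Mem e1 => (ecost e1).+1
  | Add e1 e2 | Sub e1 e2 => (ecost e1 + ecost e2).+1
  end.

(* [exec c st st' k]: from state st, the command c halts in state st' after
   k units of time.  A test succeeds when its value is nonzero. *)
Inductive exec : cmd -> state -> state -> nat -> Prop :=
  | exec_Skip st :
      exec Skip st st 1
  | exec_Assign st i e :
      exec (Assign i e) st
           (State (update (regs st) i (eval st e)) (mem st))
           (ecost e).+1
  | exec_Store st ea ev :
      exec (Store ea ev) st
           (State (regs st) (update (mem st) (eval st ea) (eval st ev)))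
           (ecost ea + ecost ev).+1
  | exec_Seq c1 c2 st1 st2 st3 k1 k2 :
      exec c1 st1 st2 k1 -> exec c2 st2 st3 k2 ->
      exec (Seq c1 c2) st1 st3 (k1 + k2)
  | exec_If e c1 c2 st st' k :
      exec (if eval st e != 0 then c1 else c2) st st' k ->
      exec (If e c1 c2) st st' (ecost e + k).+1
  | exec_While_end e c st :
      eval st e = 0 ->
      exec (While e c) st st (ecost e).+1
  | exec_While_step e c st1 st2 st3 k1 k2 :
      eval st1 e != 0 ->
      exec c st1 st2 k1 -> exec (While e c) st2 st3 k2 ->
      exec (While e c) st1 st3 (ecost e + k1 + k2).+1.

(* The input words occupy the memory cells 0, 1, 2, ...; all other cells and
   all registers are 0 initially. *)
Definition init (input : seq nat) : state := State (fun=> 0) (nth 0 input).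

(* [computes P input output k]: on the given input, P halts after k units of
   time with the output words in the memory cells 0, 1, 2, ... *)
Definition computes (P : cmd) (input output : seq nat) (k : nat) : Prop :=
  exists2 st : state, exec P (init input) st k &
    forall i, i < size output -> mem st i = nth 0 output i.

(* Number of binary digits, the digit count of 0 being 1. *)
Definition bit_size (input : seq nat) : nat :=
  \sum_(x <- input) (trunc_log 2 x).+1.

Definition encode_set (n : nat) (S : {set 'I_n}) : seq nat :=
  [seq (i \in S : nat) | i <- enum 'I_n].

(* Row-major adjacency matrix. *)
Definition encode_rel (n : nat) (e : rel 'I_n) : seq nat :=
  flatten [seq encode_set [set j | e i j] | i <- enum 'I_n].

Definition encode_instance (n : nat) (G : rel 'I_n) (s t : 'I_n) (L : nat)
    (m : nat) (T : rel 'I_m) (root : 'I_m) (B : 'I_m -> {set 'I_n}) : seq nat :=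
  [:: n; m; s : nat; t : nat; L; root : nat] ++
  encode_rel G ++ encode_rel T ++
  flatten [seq encode_set (B a) | a <- enum 'I_m].

(* Main.v *)
(* Re-root the tree at a node whose bag contains [s], and contract leaves into
   their neighbours until only the root is left, each surviving node hosting the
   union of the bags contracted into it.  Before contracting a leaf [a], and at
   the end for the root, look for an s-t path of length at most [L] among the
   vertices hosted by [a] that are not yet cut; if there is one, cut all of
   [B a] except [s] and [t].  Thanks to the choice of the root, [s] lies in
   [B a] whenever it is hosted by [a], so each round cuts at most tau vertices.
   The paths found are internally disjoint: a later short path meeting the
   vertices hosted by [a] would have all its inner vertices hosted by [a] and
   outside [B a], hence be hosted by one of the nodes contracted into [a], where
   no short path is left.  So every L-bounded cut has at least one private
   vertex per round.  Path lengths are tested by min(L, n) rounds of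
   breadth-first search, which is polynomial even for huge [L].

   The machine program is written in a language of bounded loops, in which the
   loop bounds are registers that are never reassigned; termination and a
   polynomial time bound then hold for all programs at once. *)

Require Import Defs.
From mathcomp Require Import all_boot zify.

Set Implicit Arguments.
Unset Strict Implicit.
Unset Printing Implicit Defensive.

(** * Bounded-loop programs *)

Inductive prog : Type :=
  | PSkip
  | PSet of nat & expr
  | PStore of nat & expr & expr
  | POut of expr & expr
  | PSeq of prog & prog
  | PIf of expr & prog & prog
  | PFor of nat & nat & prog.

Definition edbl (e : expr) : expr := Add e e.

(** The machine has no multiplication, so the stride 8 of the interleaved arrays comes from three
    doublings. *)
Definition eaddr (k : nat) (e : expr) : expr :=
  Add (Reg 5) (Add (edbl (edbl (edbl e))) (Lit k)).

Fixpoint compile (c : prog) : cmd :=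
  match c with
  | PSkip => Skip
  | PSet r e => Assign r e
  | PStore k e1 e2 => Store (eaddr k e1) e2
  | POut e1 e2 => Store e1 e2
  | PSeq c1 c2 => Seq (compile c1) (compile c2)
  | PIf e c1 c2 => If e (compile c1) (compile c2)
  | PFor r b c =>
      Seq (Assign r (Lit 0))
          (While (Defs.Sub (Reg b) (Reg r))
             (Seq (compile c) (Assign r (Add (Reg r) (Lit 1)))))
  end.

Definition setr (st : state) (r v : nat) : state :=
  State (update (regs st) r v) (Defs.mem st).

Definition setm (st : state) (i v : nat) : state :=
  State (regs st) (update (Defs.mem st) i v).

(** A total semantics: a loop reads its bound once, on entry. For [wf] programs the bound register
    cannot change during the loop, so this agrees with the compiled [While], which rereads it. *)
Fixpoint den (c : prog) (st : state) : state :=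
  match c with
  | PSkip => st
  | PSet r e => setr st r (eval st e)
  | PStore k e1 e2 => setm st (eval st (eaddr k e1)) (eval st e2)
  | POut e1 e2 => setm st (eval st e1) (eval st e2)
  | PSeq c1 c2 => den c2 (den c1 st)
  | PIf e c1 c2 => if eval st e != 0 then den c1 st else den c2 st
  | PFor r b c =>
      iter (regs st b)
        (fun st' => let st'' := den c st' in setr st'' r (regs st'' r + 1))
        (setr st r 0)
  end.

Fixpoint assigned (c : prog) : seq nat :=
  match c with
  | PSet r _ => [:: r]
  | PSeq c1 c2 | PIf _ c1 c2 => assigned c1 ++ assigned c2
  | PFor r _ c => r :: assigned c
  | _ => [::]
  end.

(* Array 8 does not exist: it stands for the raw stores of [POut]. *)
Fixpoint stored (c : prog) : seq nat :=
  match c with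
  | PStore k _ _ => [:: k]
  | POut _ _ => [:: 8]
  | PSeq c1 c2 | PIf _ c1 c2 => stored c1 ++ stored c2
  | PFor _ _ c => stored c
  | _ => [::]
  end.

(** The registers below [q] are read-only and contain all loop bounds, so a bound [N] on their
    initial contents limits every loop, however deeply nested. *)
Fixpoint wf (q : nat) (c : prog) : bool :=
  match c with
  | PSet r _ => q <= r
  | PSeq c1 c2 | PIf _ c1 c2 => wf q c1 && wf q c2
  | PFor r b c => [&& q <= r, b < q, r \notin assigned c & wf q c]
  | _ => true
  end.

(** Both branches of a test are charged. In a loop, resetting the counter costs 2 and the failing
    test 4; each iteration pays 4 for the test and 4 for the increment besides its body. *)
Fixpoint cost (c : prog) (N : nat) : nat :=
  match c with
  | PSkip => 1
  | PSet _ e => (ecost e).+1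
  | PStore k e1 e2 => (ecost (eaddr k e1) + ecost e2).+1
  | POut e1 e2 => (ecost e1 + ecost e2).+1
  | PSeq c1 c2 => cost c1 N + cost c2 N
  | PIf e c1 c2 => (ecost e + (cost c1 N + cost c2 N)).+1
  | PFor _ _ c => 6 + N * (cost c N + 8)
  end.

Lemma regs_den (c : prog) (st : state) (x : nat) :
  x \notin assigned c -> regs (den c st) x = regs st x.
Proof.
elim: c st => [|r e|k e1 e2|e1 e2|c1 IH1 c2 IH2|e c1 IH1 c2 IH2|r b c IH] st //=.
- by rewrite inE /update => /negPf->.
- by rewrite mem_cat negb_or => /andP[h1 h2]; rewrite IH2 // IH1.
- by rewrite mem_cat negb_or => /andP[h1 h2]; case: ifP => _; rewrite ?IH1 ?IH2.
rewrite inE negb_or => /andP[/negPf xr xc].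
elim: (regs st b) => [|n IHn] /=; rewrite /update xr //.
by rewrite IH.
Qed.

Lemma mem_den (c : prog) (st : state) :
  stored c = [::] -> Defs.mem (den c st) = Defs.mem st.
Proof.
elim: c st => [|x e|k e1 e2|e1 e2|c1 IH1 c2 IH2|e c1 IH1 c2 IH2|x b c IH] st //=.
- by case E1: (stored c1) => //= E2; rewrite IH2 ?IH1.
- by case E1: (stored c1) => //= E2; case: ifP => _; rewrite ?IH1 ?IH2.
by move=> E; elim: (regs st b) => [|k IHk] //=; rewrite IH.
Qed.

Lemma wf_assigned (q : nat) (c : prog) (x : nat) :
  wf q c -> x < q -> x \notin assigned c.
Proof.
move=> + xq.
elim: c => [|r e|k e1 e2|e1 e2|c1 IH1 c2 IH2|e c1 IH1 c2 IH2|r b c IH] //=.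
- by move=> qr; rewrite inE neq_ltn (leq_trans xq qr).
- by move=> /andP[h1 h2]; rewrite mem_cat negb_or IH1 ?IH2.
- by move=> /andP[h1 h2]; rewrite mem_cat negb_or IH1 ?IH2.
by move=> /and4P[qr _ _ h]; rewrite inE negb_or IH // neq_ltn (leq_trans xq qr).
Qed.

Lemma exec_compile (q N : nat) (c : prog) (st : state) :
  wf q c -> (forall x, x < q -> regs st x <= N) ->
  exists2 k, exec (compile c) st (den c st) k & k <= cost c N.
Proof.
elim: c st => [|r e|k e1 e2|e1 e2|c1 IH1 c2 IH2|e c1 IH1 c2 IH2|r b c IH] st.
- by exists 1; first exact: exec_Skip.
- by exists (ecost e).+1; first exact: exec_Assign.
- by exists (ecost (eaddr k e1) + ecost e2).+1; first exact: exec_Store.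
- by exists (ecost e1 + ecost e2).+1; first exact: exec_Store.
- move=> /= /andP[w1 w2] hN; have [k1 E1 le1] := IH1 st w1 hN.
  have hN' x : x < q -> regs (den c1 st) x <= N.
    by move=> xq; rewrite regs_den ?hN // (wf_assigned w1).
  have [k2 E2 le2] := IH2 _ w2 hN'.
  by exists (k1 + k2); [exact: exec_Seq E1 E2 | exact: leq_add].
- move=> /= /andP[w1 w2] hN.
  have [k E le] : exists2 k, exec (if eval st e != 0 then compile c1 else compile c2)
      st (if eval st e != 0 then den c1 st else den c2 st) k
      & k <= cost c1 N + cost c2 N.
    case: ifP => _.
      by have [k E le] := IH1 st w1 hN; exists k => //; apply: leq_trans le (leq_addr _ _).
    by have [k E le] := IH2 st w2 hN; exists k => //; apply: leq_trans le (leq_addl _ _).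
  exists (ecost e + k).+1; first by apply: exec_If; move: E; case: (_ != 0).
  by rewrite ltnS leq_add2l.
move=> /= /and4P[qr bq rc wc] hN.
set body := fun st' : state => _.
set E := Defs.Sub _ _.
have rb : (r == b) = false by apply/negbTE; rewrite neq_ltn (leq_trans bq qr) orbT.
have bc : b \notin assigned c by exact: wf_assigned wc bq.
(* Induction on the number [j] of remaining iterations, the gap between the counter and its
   bound. *)
have loop j st' : regs st' r + j = regs st' b -> regs st' b <= N ->
    (forall x, x < q -> regs st' x <= N) ->
    exists2 k, exec (While E (Seq (compile c) (Assign r (Add (Reg r) (Lit 1)))))
      st' (iter j body st') k & k <= 4 + j * (cost c N + 8).
  elim: j st' => [|j IHj] st' ej bN hN'.
    by exists 4 => //; apply: exec_While_end; rewrite /= -ej addn0 subnn.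
  have [k1 E1 le1] := IH st' wc hN'.
  have eb : regs (body st') b = regs st' b.
    by rewrite /body /= /update eq_sym rb regs_den.
  have er : regs (body st') r = (regs st' r).+1.
    by rewrite /body /= /update eqxx regs_den // addn1.
  have [|||k2 E2 le2] := IHj (body st').
  - by rewrite eb er addSnnS.
  - by rewrite eb.
  - move=> x xq; rewrite /body /= /update.
    have /negbTE-> : x != r by rewrite neq_ltn (leq_trans xq qr).
    by rewrite regs_den ?hN' // (wf_assigned wc).
  exists (ecost E + (k1 + 4) + k2).+1; last by rewrite /=; lia.
  rewrite iterSr; apply: exec_While_step E2.
    by rewrite /= -ej; lia.
  by apply: exec_Seq E1 _; exact: exec_Assign.
have [|||k Ek le] := loop (regs st b) (setr st r 0).
- by rewrite /= /update eqxx eq_sym rb.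
- by rewrite /= /update eq_sym rb hN.
- move=> x xq; rewrite /= /update.
  have /negbTE-> : x != r by rewrite neq_ltn (leq_trans xq qr).
  exact: hN.
exists (2 + k); first by apply: exec_Seq Ek; exact: exec_Assign.
have := hN b bq; rewrite -(leq_pmul2r (m := cost c N + 8)) ?addnS //.
by move: le; rewrite /= !addnS; lia.
Qed.

(** Each loop raises the degree by one; sequences and tests add the constants and, crudely, the
    degrees. *)
Lemma cost_poly (c : prog) :
  exists C d, forall N, cost c N <= C * N.+1 ^ d.
Proof.
have up C d d' N : d <= d' -> C * N.+1 ^ d <= C * N.+1 ^ d'.
  by move=> dd; rewrite leq_mul2l leq_pexp2l ?orbT.
elim: c => [|r e|k e1 e2|e1 e2|c1 [C1 [d1 H1]] c2 [C2 [d2 H2]]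
    |e c1 [C1 [d1 H1]] c2 [C2 [d2 H2]]|r b c [C [d H]]].
- by exists 1, 0.
- by exists (ecost e).+1, 0 => N; rewrite expn0 muln1.
- by exists (ecost (eaddr k e1) + ecost e2).+1, 0 => N; rewrite expn0 muln1.
- by exists (ecost e1 + ecost e2).+1, 0 => N; rewrite expn0 muln1.
- exists (C1 + C2), (d1 + d2) => N /=; rewrite mulnDl leq_add //.
    by apply: leq_trans (H1 N) (up _ _ _ _ _); rewrite leq_addr.
  by apply: leq_trans (H2 N) (up _ _ _ _ _); rewrite leq_addl.
- exists ((ecost e).+1 + (C1 + C2)), (d1 + d2) => N /=.
  rewrite -addSn mulnDl leq_add //.
    by rewrite leq_pmulr // expn_gt0.
  rewrite mulnDl leq_add //.
    by apply: leq_trans (H1 N) (up _ _ _ _ _); rewrite leq_addr.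
  by apply: leq_trans (H2 N) (up _ _ _ _ _); rewrite leq_addl.
(* 14 absorbs the constants 6 and 8 of a loop, since [N.+1 ^ d] is positive. *)
exists (C + 14), d.+1 => N /=; rewrite expnS.
have p : 0 < N.+1 ^ d by rewrite expn_gt0.
move: (H N) p; set x := cost c N; set y := N.+1 ^ d => xy p.
have : N * x <= N * (C * y) by rewrite leq_mul2l xy orbT.
nia.
Qed.

(** * Frame conditions and loop invariants for array programs *)

(* Cell [i] of array [k] is at address [X + 8 * i + k], where [X] is the
   content of register 5. *)
Section Frames.
Variable X : nat.

Definition view (st : state) (k i : nat) : nat := Defs.mem st (X + (8 * i + k)).

(** The frame relation that carries facts past a piece of code. Its last clause protects the input,
    which will occupy the cells below [X]. *)
Definition same (rs ks : seq nat) (st st' : state) : Prop :=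
  [/\ forall x, x \notin rs -> regs st' x = regs st x,
      forall k i, k < 8 -> k \notin ks -> view st' k i = view st k i
    & forall i, i < X -> Defs.mem st' i = Defs.mem st i].

Lemma same_trans (rs ks : seq nat) (st1 st2 st3 : state) :
  same rs ks st1 st2 -> same rs ks st2 st3 -> same rs ks st1 st3.
Proof.
move=> [r1 v1 m1] [r2 v2 m2]; split=> [x h|k i k8 h|i h].
- by rewrite r2 ?r1.
- by rewrite v2 ?v1.
- by rewrite m2 ?m1.
Qed.

Lemma same_sub (rs ks rs' ks' : seq nat) (st1 st2 : state) :
  {subset rs <= rs'} -> {subset ks <= ks'} ->
  same rs ks st1 st2 -> same rs' ks' st1 st2.
Proof.
move=> hr hk [r1 v1 m1]; split=> // [x h|k i k8 h].
- by rewrite r1 //; apply: contra h; exact: hr.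
- by rewrite v1 //; apply: contra h; exact: hk.
Qed.

Lemma eval_eaddr (st : state) (k : nat) (e : expr) :
  eval st (eaddr k e) = regs st 5 + (8 * eval st e + k).
Proof. rewrite /=; lia. Qed.

Lemma view_setm (st : state) (k i v k' i' : nat) :
  k < 8 -> k' < 8 ->
  view (setm st (X + (8 * i + k)) v) k' i' =
  if (k' == k) && (i' == i) then v else view st k' i'.
Proof.
move=> hk hk'; rewrite /view /= /update eqn_add2l.
by congr (if _ then _ else _); apply/idP/idP => [|/andP[/eqP-> /eqP->]] //; lia.
Qed.

Lemma view_store (st : state) (k : nat) (e1 e2 : expr) (k' i' : nat) :
  regs st 5 = X -> k < 8 -> k' < 8 ->
  view (den (PStore k e1 e2) st) k' i' =
  if (k' == k) && (i' == eval st e1) then eval st e2 else view st k' i'.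
Proof. by move=> hX k8 k8'; rewrite /den eval_eaddr hX view_setm. Qed.

(** With register 5 fixed and raw stores excluded, every write lands at or above [X], inside one of
    the eight arrays. *)
Definition tame (c : prog) : bool :=
  (5 \notin assigned c) && all (fun k => k < 8) (stored c).

Lemma same_den (c : prog) (st : state) :
  tame c -> regs st 5 = X -> same (assigned c) (stored c) st (den c st).
Proof.
rewrite /tame.
elim: c st => [|r e|k e1 e2|e1 e2|c1 IH1 c2 IH2|e c1 IH1 c2 IH2|r b c IH] st.
- by [].
- by move=> _ hX; split=> // x; rewrite inE /= /update => /negPf->.
- rewrite [stored _]/= [assigned _]/= all_seq1 => /andP[_ k8] hX; split=> //.
  + by move=> k' i k8' kk; rewrite view_store //; move: kk; rewrite inE => /negPf->.
  + move=> i iX; rewrite /den eval_eaddr hX /= /update; case: eqP => //; lia.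
- by rewrite [all _ _]/= andbF.
- rewrite /= mem_cat negb_or all_cat => /andP[/andP[a1 a2] /andP[s1 s2]] hX.
  apply: (same_trans (st2 := den c1 st)).
    apply: same_sub (IH1 st _ hX); rewrite ?a1 ?s1 //.
      by move=> x h; rewrite mem_cat h.
    by move=> x h; rewrite mem_cat h.
  apply: same_sub (IH2 (den c1 st) _ _); rewrite ?a2 ?s2 ?regs_den //.
    by move=> x h; rewrite mem_cat h orbT.
  by move=> x h; rewrite mem_cat h orbT.
- rewrite /= mem_cat negb_or all_cat => /andP[/andP[a1 a2] /andP[s1 s2]] hX.
  case: ifP => _.
    apply: same_sub (IH1 st _ hX); rewrite ?a1 ?s1 //.
      by move=> x h; rewrite mem_cat h.
    by move=> x h; rewrite mem_cat h.
  apply: same_sub (IH2 st _ _); rewrite ?a2 ?s2 ?regs_den //.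
    by move=> x h; rewrite mem_cat h orbT.
  by move=> x h; rewrite mem_cat h orbT.
rewrite /= inE negb_or => /andP[/andP[/negPf r5 a] s] hX.
have s0 rr v st' : r \in rr -> same rr (stored c) st' (setr st' r v).
  move=> hr; split=> // x; rewrite /= /update.
  by case: eqP => // ->; rewrite hr.
elim: (regs st b) => [|n IHn] /=; first by apply: s0; rewrite inE eqxx.
apply: same_trans IHn _; set st' := iter _ _ _.
have hX' : regs st' 5 = X.
  rewrite /st'; elim: (n) => [|j IHj] /=; rewrite /update r5 //.
  by rewrite regs_den.
apply: same_trans (s0 _ _ _ _); last by rewrite inE eqxx.
apply: same_sub (IH st' _ hX'); rewrite ?a ?s //.
by move=> x h; rewrite inE h orbT.
Qed.

(** Invariant rule for loops. Besides the invariant, each iteration may use the frame relation to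
    the state before the loop, so [I] need not mention what the loop leaves alone. *)
Lemma for_rule (r b : nat) (c : prog) (I : nat -> state -> Prop) (st : state)
    (N : nat) :
  tame (PFor r b c) -> (r != b) && (r \notin assigned c) && (b \notin assigned c) ->
  regs st 5 = X -> regs st b = N ->
  I 0 (setr st r 0) ->
  (forall (i : 'I_N) (st' : state),
     same (r :: assigned c) (stored c) st st' -> eval st' (Reg r) = i ->
     I i st' -> I i.+1 (setr (den c st') r i.+1)) ->
  I N (den (PFor r b c) st).
Proof.
move=> tc /andP[/andP[rb rc] bc] hX hb I0 IS /=; rewrite hb.
set body := fun st' : state => _.
suff H j : j <= N -> [/\ same (r :: assigned c) (stored c) st (iter j body (setr st r 0)),
    regs (iter j body (setr st r 0)) r = j & I j (iter j body (setr st r 0))].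
  by have [] := H N (leqnn _).
elim: j => [|j IHj] jN.
  split=> //=; last by rewrite /update eqxx.
  by split=> //= x; rewrite inE negb_or /update => /andP[/negPf->].
have [s1 r1 I1] := IHj (ltnW jN); rewrite iterS; set st' := iter j body _ in s1 r1 I1 *.
have rS : regs (den c st') r + 1 = j.+1 by rewrite regs_den // r1 addn1.
have tc' : tame c by move: tc; rewrite /tame /= inE negb_or => /andP[/andP[_ ->] ->].
have hX' : regs st' 5 = X.
  by case: s1 => -> //; move: tc; rewrite /tame /= => /andP[].
split.
- apply: same_trans s1 _; apply: (same_trans (st2 := den c st')).
    apply: same_sub (same_den tc' hX') => //.
    by move=> x h; rewrite inE h orbT.
  by split=> //= x; rewrite inE negb_or /update => /andP[/negPf->].
- by rewrite /body /= /update eqxx.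
- by rewrite /body /= rS; apply: (IS (Ordinal jN)).
Qed.

(** Iteration [i] touches only cell [i] of array [k], hence still finds the original content there:
    updating in place is safe. *)
Lemma for_map (k r b : nat) (c : prog) (st : state) (N : nat) (f : 'I_N -> nat) :
  tame (PFor r b c) -> (r != b) && (r \notin assigned c) && (b \notin assigned c) ->
  k < 8 -> regs st 5 = X -> regs st b = N ->
  (forall (i : 'I_N) (st' : state),
     same (r :: assigned c) (stored c) st st' -> eval st' (Reg r) = i ->
     view st' k i = view st k i ->
     forall j, view (den c st') k j = if j == i then f i else view st' k j) ->
  forall j : 'I_N, view (den (PFor r b c) st) k j = f j.
Proof.
move=> tc hr k8 hX hb H j.
pose I i st' := forall j : 'I_N, view st' k j = if j < i then f j else view st k j.
suff /(_ j) : I N (den (PFor r b c) st) by rewrite ltn_ord.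
apply: for_rule => // i st' hs hi hI j'.
rewrite {1}/view /= -/(view _ _ _) (H i st' hs hi) ?hI ?ltnn //.
rewrite [in RHS]ltnS [in RHS]leq_eqVlt (inj_eq (@ord_inj N)).
by case: eqVneq => [->|] //; rewrite leqnn.
Qed.

Lemma for_store (k r b : nat) (e : expr) (st : state) (N : nat) (f : 'I_N -> nat) :
  (r != b) && (r != 5) && (k < 8) -> regs st 5 = X -> regs st b = N ->
  (forall (i : 'I_N) (st' : state),
     same [:: r] [:: k] st st' -> eval st' (Reg r) = i ->
     view st' k i = view st k i -> eval st' e = f i) ->
  forall j : 'I_N, view (den (PFor r b (PStore k (Reg r) e)) st) k j = f j.
Proof.
move=> /andP[/andP[rb r5] k8] hX hb H.
apply: for_map => //; first by rewrite /tame /= inE eq_sym r5 k8.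
  by rewrite rb.
move=> i st' hs hi hv j; rewrite view_store //; last first.
  by case: hs => -> //; rewrite inE eq_sym.
by rewrite eqxx hi (H i st').
Qed.

End Frames.

(** * Short paths *)

Section ShortPaths.
Variables (V : finType) (G : rel V) (s t : V).

Definition grow (A R : {set V}) : {set V} :=
  R :|: [set v in A | [exists u in R, G u v]].

(** Breadth-first search inside [A]. Starting from the intersection with [A] makes the search empty
    when [s] is not allowed. *)
Definition reach (A : {set V}) (k : nat) : {set V} :=
  iter k (grow A) (A :&: [set s]).

Lemma reachP (A : {set V}) (k : nat) (v : V) :
  reflect (exists p, [/\ s \in A, path (induced A G) s p, last s p = v & size p <= k])
          (v \in reach A k).
Proof.
elim: k v => [|k IHk] v; rewrite /reach /=.
  rewrite !inE; apply: (iffP andP) => [[vA /eqP vs]|[p [sA _ <-]]].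
    by exists [::]; rewrite -vs.
  by rewrite leqn0 size_eq0 => /eqP->; rewrite /= sA eqxx.
rewrite -/(reach A k) /grow !inE; apply: (iffP orP).
- case=> [/IHk[p [sA hp lp kp]]|/andP[vA /exists_inP[u /IHk[p [sA hp lp kp]] uv]]].
    by exists p; rewrite (leq_trans kp).
  exists (rcons p v); rewrite rcons_path last_rcons size_rcons hp lp.
  split=> //; rewrite /induced /= vA uv andbT.
  case/lastP: p lp hp {kp} => [/= <-|p w]; first by rewrite sA.
  by rewrite last_rcons rcons_path => <- /andP[_ /and3P[_ -> _]].
- case=> p; case/lastP: p => [|p w] [sA].
    by move=> _ <- _; left; apply/IHk; exists [::].
  rewrite rcons_path last_rcons size_rcons => /andP[hp /and3P[_ wA uw]] <- kp.
  right; rewrite wA; apply/exists_inP; exists (last s p) => //.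
  by apply/IHk; exists p.
Qed.

Definition short_path (L : nat) (A : {set V}) (p : seq V) : Prop :=
  st_path (induced A G) s t p /\ size p <= L.

(** The search finds walks; shortening them gives simple paths that are no longer. Conversely a
    simple path has fewer than [#|V|] edges, so capping the rounds at [#|V|] loses nothing. *)
Lemma reach_short (L : nat) (A : {set V}) :
  s != t ->
  reflect (exists p, short_path L A p) (t \in reach A (minn L #|V|)).
Proof.
move=> st; apply: (iffP (reachP _ _ _)) => [[p [_ hp lp kp]]|[p [[hp lp up] kp]]].
  move: lp kp; case/shortenP: hp => p' hp' up' sp' lp' kp.
  exists p'; split; first by split.
  have: size p' <= size p by apply: uniq_leq_size => //; case/andP: up'.
  by move=> h; apply: leq_trans h (leq_trans kp (geq_minl _ _)).
exists p; split=> //.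
  (* As [s != t], the path has a first edge, and that edge puts [s] into [A]. *)
  case: p lp hp {up kp} => [/= e|x p _ /= /andP[/and3P[]]] //.
  by rewrite e eqxx in st.
rewrite leq_min kp /=; have /= := card_uniqP up.
have := max_card (ssrbool.mem (s :: p)); rewrite /= => + E.
by rewrite E; apply: leq_trans.
Qed.

Lemma path_induced (A : {set V}) (x : V) (p : seq V) :
  path (induced A G) x p -> {subset p <= A}.
Proof.
elim: p x => //= y p IH x /andP[/and3P[_ yA _] hp] z.
by rewrite inE => /predU1P[->|/(IH _ hp)].
Qed.

Lemma sub_induced (A A' : {set V}) (x : V) (p : seq V) :
  path (induced A G) x p -> {subset x :: p <= A'} -> path (induced A' G) x p.
Proof.
elim: p x => //= y p IH x /andP[/and3P[_ _ xy] hp] h.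
rewrite {1}/induced /= xy !h ?inE ?eqxx ?orbT //=; apply: IH => // z zp; apply: h.
by rewrite inE zp orbT.
Qed.

End ShortPaths.

(** * The greedy cut *)

Section Greedy.
Variables (V A : finType) (G : rel V) (T : rel A) (B : A -> {set V}).
Variables (s t : V) (L : nat) (r : A).
Hypotheses (sgG : simple_graph G) (neq_st : s != t) (nadj_st : ~~ G s t).
Hypotheses (td : tree_decomposition G T B) (sBr : s \in B r).

Notation short := (short_path G s t L).

(** Since [s] and [t] are distinct and not adjacent, the path has inner vertices next to both of its
    ends. *)
Lemma internal_endpoints (S : {set V}) (p : seq V) :
  st_path (induced S G) s t p ->
  (exists x, [/\ x \in p, x != t & G s x]) /\
  (exists x, [/\ x \in p, x != t & G x t]).
Proof.
case=> hp lp up; split.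
  case: p lp hp up => [/= e|x p _ /= /andP[/and3P[_ _ sx] _] _].
    by move: neq_st; rewrite e eqxx.
  exists x; rewrite inE eqxx; split=> //.
  by apply: contraNneq nadj_st => e; rewrite -e.
case/lastP: p lp hp up => [/= e|p x]; first by move: neq_st; rewrite e eqxx.
rewrite last_rcons rcons_path => -> /andP[hp /and3P[_ _ h]].
rewrite -rcons_cons rcons_uniq => /andP[tp _].
case/lastP: p tp hp h => [_ _ /= h|p y]; first by move: nadj_st; rewrite h.
rewrite last_rcons => tp _ h; exists y; split=> //.
  by rewrite mem_rcons inE mem_rcons inE eqxx orbT.
by apply: contraNneq tp => <-; rewrite inE mem_rcons inE eqxx orbT.
Qed.

(** The inner vertices of a path induce a connected graph, so a set closed under edges to inner
    vertices contains all of them as soon as it contains one. *)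
Lemma internal_closed (S C : {set V}) (p : seq V) (x y : V) :
  st_path (induced S G) s t p ->
  (forall u v, v \in C -> G v u -> u \in p -> u != t -> u \in C) ->
  x \in p -> x != t -> x \in C -> y \in p -> y != t -> y \in C.
Proof.
case; case/lastP: p => [//|q z]; rewrite last_rcons => + -> + hC.
rewrite rcons_path => /andP[hq _]; rewrite -rcons_cons rcons_uniq.
case/andP=> tq /= /andP[sq _].
rewrite !mem_rcons !inE => xq xt xC yq yt; rewrite (negPf xt) (negPf yt) /= in xq yq.
(* [D] consists of the inner vertices: [s] is not listed in the sequence, and [t] was split off as
   its last entry. *)
pose D : {set V} := [set v in q].
have qD : {subset q <= D} by move=> u; rewrite inE.
have hD u : u \in D -> u \in rcons q t /\ u != t.
  rewrite inE mem_rcons inE => uq; rewrite uq orbT; split=> //.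
  by apply: contraNneq tq => <-; rewrite inE uq orbT.
move: hC; case: q {tq sq} D hq hD qD xq yq => [//|z0 q] D /= /andP[_ hq] hD qD xq yq hC.
have hq' : path (induced D G) z0 q by apply: sub_induced hq _.
have sym : connect_sym (induced D G).
  apply: sym_connect_sym => u v; rewrite /induced /= sgG.1.
  by rewrite [LHS]andbCA.
have cl : closed (induced D G) (ssrbool.mem C).
  apply: (intro_closed sym) => u v /and3P[_ /hD[vq vt] uv] uC.
  exact: hC uC uv vq vt.
rewrite -(closed_connect cl (path_connect hq' yq)).
by rewrite (closed_connect cl (path_connect hq' xq)).
Qed.

Lemma short_sub (S S' : {set V}) (p : seq V) :
  S \subset S' -> short S p -> short S' p.
Proof.
move=> /subsetP h [[hp lp up] kp]; split=> //; split=> //.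
apply: sub_path hp => u v /and3P[uS vS uv].
by rewrite /induced /= !h.
Qed.

Lemma short_restrict (S S' : {set V}) (p : seq V) :
  short S p -> s \in S' -> {subset p <= S'} -> short S' p.
Proof.
move=> [[hp lp up] kp] sS' pS'; split=> //; split=> //.
by apply: sub_induced hp _ => x; rewrite inE => /predU1P[->|/pS'].
Qed.

Lemma connect_ind (U : finType) (e : rel U) (P : U -> Prop) (x y : U) :
  (forall u v, e u v -> P u -> P v) -> connect e x y -> P x -> P y.
Proof.
move=> h /connectP[p hp ->]; elim: p x hp => //= z p IH x /andP[xz hp] Px.
by apply: IH hp _; apply: h xz Px.
Qed.

(* [rho] maps a node to the one into which it has been contracted, so that the
   surviving nodes are its fixpoints and [hosted rho a] is the union of the bags
   contracted into [a]. *)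
Definition hosted (rho : A -> A) (a : A) : {set V} :=
  [set v | [exists b, (rho b == a) && (v \in B b)]].

Definition contract (rho : A -> A) (a p : A) : A -> A :=
  fun b => if rho b == a then p else rho b.

(** The quantified boolean equality says that [p] is the only surviving neighbour of [a] in [T]. *)
Definition leaf (rho : A -> A) (a p : A) : bool :=
  [&& a != r, rho a == a & [forall b, (T a b && (rho b == b)) == (b == p)]].

Definition cut (rho : A -> A) (a : A) (F : {set V}) : {set V} :=
  if t \in reach G s (hosted rho a :\: F) (minn L #|V|)
  then F :|: (B a :\: [set s; t]) else F.

(* [Z] is a set of vertices which no short path surviving [F] visits and in
   which every cut has already paid for [F]. *)
Record greedy_inv (rho : A -> A) (F : {set V}) : Prop := GreedyInv {
  inv_idem : forall b, rho (rho b) = rho b;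
  inv_root : rho r = r;
  inv_edge : forall x y, T x y -> rho x = rho y \/ T (rho x) (rho y);
  inv_nbr : forall a u v, rho a = a -> v \in hosted rho a -> v \notin B a ->
    G v u -> u \in hosted rho a;
  inv_nopath : forall a p, rho a = a -> short (~: F) p ->
    ~ (forall x, x \in p -> x != t -> x \in hosted rho a :\: B a);
  inv_s : forall a, rho a = a -> s \in hosted rho a -> s \in B a;
  inv_F : F \subset ~: [set s; t];
  inv_opt : exists Z : {set V},
    (forall p x, short (~: F) p -> x \in p -> x != t -> x \notin Z) /\
    (forall X, bounded_cut G s t L X -> #|F| <= width B * #|X :&: Z|) }.

Lemma hostedP (rho : A -> A) (a : A) (v : V) :
  reflect (exists2 b, rho b = a & v \in B b) (v \in hosted rho a).
Proof.
rewrite inE; apply: (iffP existsP) => [[b /andP[/eqP h1 h2]]|[b h1 h2]].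
  by exists b.
by exists b; rewrite h1 eqxx.
Qed.

(** Before any contraction a node hosts exactly its bag, so nothing is hosted outside a bag, while
    every s-t path has an inner vertex. *)
Lemma inv_init : greedy_inv id set0.
Proof.
have W a v : v \in hosted id a -> v \in B a by case/hostedP => b ->.
split=> //.
- by move=> x y; right.
- by move=> a u v _ /W->.
- move=> a p _ [hp _] h; have [[x [xp xt _]] _] := internal_endpoints hp.
  by have := h x xp xt; rewrite inE => /andP[/negP h1 /W].
- by move=> a _ /W.
- exact: sub0set.
by exists set0; split=> [p x|X _]; rewrite ?inE // cards0.
Qed.

(** The bag loses at least the vertex [s], which compensates for the [-1] in the definition of the
    width. *)
Lemma card_bag_cut (a : A) : s \in B a -> #|B a :\: [set s; t]| <= width B.
Proof.
move=> sa; rewrite /width.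
have h : #|B a| <= \max_(b : A) #|B b| by exact: (leq_bigmax a).
have : #|B a :\: [set s; t]| <= #|B a :\ s|.
  by apply/subset_leq_card/setDS; rewrite sub1set !inE eqxx.
by have := cardsD1 s (B a); rewrite sa; lia.
Qed.

Let set_inE := (in_setD, in_setC, in_setI, in_setU, in_set1).

(** After a cut at [a], no surviving short path meets the vertices hosted by [a]. All of these
    except [s] and [t] can thus join [Z], and the path just found forces one more vertex of every
    bounded cut into [Z], which pays for the at most [width B] new vertices. *)
Lemma inv_cut (rho : A -> A) (a : A) (F : {set V}) :
  greedy_inv rho F -> rho a = a ->
  greedy_inv rho (cut rho a F) /\
  forall p, ~ short (hosted rho a :\: cut rho a F) p.
Proof.
move=> I ra; rewrite /cut.
case: (reach_short G L (hosted rho a :\: F) neq_st) => [[P sP]|noP]; last first.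
  by split=> // p sp; apply: noP; exists p.
set F' := F :|: _.
have FF' : ~: F' \subset ~: F by rewrite setCS subsetUl.
(* A surviving path meeting the hosted vertices does so outside [B a]. By [inv_nbr] it cannot leave
   that region through an inner vertex, so all its inner vertices lie there, contradicting
   [inv_nopath]. *)
have avoid p x : short (~: F') p -> x \in p -> x != t -> x \notin hosted rho a.
  move=> sp xp xt; apply/negP => xW.
  have step u : u \in ~: F' -> u != s -> u != t -> u \in hosted rho a ->
      u \in hosted rho a :\: B a.
    rewrite !set_inE negb_or => /andP[_ +] us ut -> /=.
    by rewrite (negPf us) (negPf ut) andbT.
  have [[hp lp up] kp] := sp.
  apply: (inv_nopath I ra (short_sub FF' sp)) => y yp yt.
  apply: (internal_closed (x := x) sp.1 _ xp xt _ yp yt).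
    move=> u v; rewrite in_setD => /andP[vB vW] vu uq ut; apply: step => //.
    - exact: (path_induced hp).
    - by apply: contraTneq uq => ->; case/andP: up.
    - exact: inv_nbr I _ _ _ ra vW vB vu.
  apply: step => //; first exact: (path_induced hp).
  by apply: contraTneq xp => ->; case/andP: up.
have sW : s \in hosted rho a.
  case: sP => -[]; case: P => [_ /= e|x P /= /andP[/and3P[]]].
    by move: neq_st; rewrite e eqxx.
  by rewrite inE => /andP[].
split; last first.
  move=> p sp; have [[x [xp xt _]] _] := internal_endpoints sp.1.
  have sub : hosted rho a :\: F' \subset ~: F'.
    by apply/subsetP=> u; rewrite !set_inE => /andP[].
  have := avoid p x (short_sub sub sp) xp xt.
  by case: sp => -[/path_induced/(_ x xp)]; rewrite !set_inE => /andP[_ ->].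
split; try by case: I.
- by move=> b p rb /(short_sub FF'); exact: inv_nopath.
- by rewrite subUset (inv_F I) subsetDr.
have [Z [Z1 Z2]] := inv_opt I.
exists (Z :|: (hosted rho a :\: [set s; t])); split.
  move=> p x sp xp xt; rewrite !set_inE !negb_or (Z1 p x (short_sub FF' sp) xp xt) /=.
  by rewrite (negPf (avoid p x sp xp xt)) andbF.
move=> X hX.
(* The cut [X] must hit the short path [P], and contains neither [s] nor [t], so it hits an inner
   vertex; as [P] avoided [F], that vertex is not yet in [Z]. *)
have [x [xP xt xX]] : exists x, [/\ x \in P, x != t & x \in X].
  have [XF Xcut] := hX; case: sP => -[hp lp up] kp.
  case: (boolP [exists x in X, (x \in P) && (x != t)]).
    case/exists_inP=> x xX /andP[xP xt].
    by exists x.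
  rewrite negb_exists_in => /forall_inP h; exfalso.
  suff /Xcut : st_path (induced (~: X) G) s t P by lia.
  split=> //; apply: sub_induced hp _ => u.
  have nst w : w \in [set s; t] -> w \in ~: X.
    by move=> hw; rewrite inE; apply: contraL hw => /(subsetP XF); rewrite inE.
  rewrite inE => /predU1P[->|uP]; first by apply: nst; rewrite !set_inE eqxx.
  case: (eqVneq u t) => [->|ut]; first by apply: nst; rewrite !set_inE eqxx orbT.
  by rewrite inE; apply/negP => uX; have := h u uX; rewrite uP ut.
have sPF : short (~: F) P.
  by apply: short_sub sP; apply/subsetP=> u; rewrite !set_inE => /andP[].
have xs : x != s.
  by apply: contraTneq xP => ->; case: sP => -[_ _ /andP[]].
have xW : x \in hosted rho a.
  by case: sP => -[/path_induced/(_ x xP)]; rewrite !set_inE => /andP[].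
have xZ := Z1 P x sPF xP xt.
have : #|X :&: Z|.+1 <= #|X :&: (Z :|: (hosted rho a :\: [set s; t]))|.
  have := cardsU1 x (X :&: Z); rewrite !set_inE (negPf xZ) andbF /= add1n => <-.
  apply: subset_leq_card; apply/subsetP=> u; rewrite !set_inE.
  case/predU1P => [->|/andP[-> ->] //].
  by rewrite xX xW (negPf xs) (negPf xt) orbT.
have := card_bag_cut (inv_s I ra sW).
have : #|F'| <= #|F| + #|B a :\: [set s; t]| by rewrite /F' cardsU leq_subr.
have := Z2 X hX; set k1 := #|_ :&: Z|; set k2 := #|_ :&: _|; nia.
Qed.

(** * Contracting a leaf *)

Section Contract.
Variables (rho : A -> A) (a p : A) (F : {set V}).
Hypotheses (I : greedy_inv rho F) (lf : leaf rho a p).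

Let neq_ar : a != r. Proof. by case/and3P: lf. Qed.
Let rho_a : rho a = a. Proof. by case/and3P: lf => _ /eqP. Qed.
Let leafE (b : A) : (T a b && (rho b == b)) = (b == p).
Proof. by case/and3P: lf => _ _ /forallP/(_ b)/eqP. Qed.
Let rho_p : rho p = p.
Proof. by have := leafE p; rewrite eqxx => /andP[_ /eqP]. Qed.
Let neq_pa : p != a.
Proof.
have [[[_ irT] _ _] _ _ _] := td.
by apply/eqP => e; have := leafE p; rewrite e irT eqxx.
Qed.

Lemma contract_fix (b : A) : contract rho a p b = b -> rho b = b /\ b != a.
Proof.
rewrite /contract; case: eqP => [h e|h e]; last first.
  by split=> //; apply: contra_notN h => /eqP->; rewrite rho_a.
by move: h; rewrite -e rho_p => h; move: neq_pa; rewrite h eqxx.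
Qed.

(** The nodes whose bags contain [v] are connected in [T], and an edge leaving the nodes contracted
    into [a] can only lead to those contracted into [p]. *)
Lemma hosted_leaf (b : A) (v : V) :
  v \in hosted rho a -> v \in hosted rho b -> b != a -> v \in hosted rho p.
Proof.
case/hostedP=> x rx vx /hostedP[y ry vy] ba.
have [[[sT _] _ _] _ _ /(_ v x y vx vy) xy] := td.
case: (boolP (v \in hosted rho p)) => // vp; exfalso.
suff : rho y = a by rewrite ry => h; move: ba; rewrite h eqxx.
apply: (connect_ind (P := fun z => rho z = a) _ xy rx) => z1 z2 /and3P[].
rewrite !inE => _ v2 z12 rz1.
case: (inv_edge I z12) => [<- //|]; rewrite rz1 => h.
have := leafE (rho z2); rewrite h (inv_idem I) eqxx => /esym/eqP e.
by case/hostedP: vp; exists z2.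
Qed.

Lemma hosted_contract (b : A) (v : V) : contract rho a p b = b ->
  v \in hosted (contract rho a p) b ->
  v \in hosted rho b \/ b = p /\ v \in hosted rho a.
Proof.
move=> /contract_fix[rb ba] /hostedP[x]; rewrite /contract.
case: eqP => [rx <- vx|_ rx vx]; last by left; apply/hostedP; exists x.
by right; split=> //; apply/hostedP; exists x.
Qed.

Lemma hosted_contractS (b : A) (v : V) :
  b != a -> v \in hosted rho b -> v \in hosted (contract rho a p) b.
Proof.
move=> ba /hostedP[x rx vx]; apply/hostedP; exists x => //.
by rewrite /contract rx (negPf ba).
Qed.

Lemma hosted_contractU (v : V) :
  v \in hosted rho a -> v \in hosted (contract rho a p) p.
Proof.
move=> /hostedP[x rx vx]; apply/hostedP; exists x => //.
by rewrite /contract rx eqxx.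
Qed.

(* As [p] is the only surviving neighbour of [a], a vertex hosted by [a] but not
   by [p] is hosted nowhere else. *)
Lemma nbr_leaf (u v : V) :
  v \in hosted rho a -> v \notin hosted rho p -> G v u -> u \in hosted rho a.
Proof.
move=> va vp vu; have [_ _ /(_ v u vu)[c vc uc] _] := td.
case: (eqVneq (rho c) a) => [e|ne]; first by apply/hostedP; exists c.
case/negP: vp; apply: hosted_leaf va _ ne.
by apply/hostedP; exists c.
Qed.

(** The delicate clause is [inv_nopath] at [p]. A bad path with an inner vertex already hosted by
    [p] has all inner vertices there, which the old invariant forbids; otherwise its inner vertices
    are hosted by [a] but not by [p], which drags [s] and [t] into [a] and contradicts [noshort]. *)
Lemma inv_contract :
  (forall q, ~ short (hosted rho a :\: F) q) -> greedy_inv (contract rho a p) F.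
Proof.
move=> noshort; split; try by case: I.
- move=> b; rewrite /contract; case: (eqVneq (rho b) a) => [e|ne].
    by rewrite rho_p (negPf neq_pa).
  by rewrite (inv_idem I) (negPf ne).
- by rewrite /contract (inv_root I) eq_sym (negPf neq_ar).
- move=> x y; have [[[sT _] _ _] _ _ _] := td.
  have at_leaf c : T a (rho c) -> rho c = p.
    by move=> h; apply/eqP; rewrite -leafE h (inv_idem I) eqxx.
  move/(inv_edge I); rewrite /contract.
  case: (eqVneq (rho x) a) => [ex|nx]; case: (eqVneq (rho y) a) => [ey|ny] //.
  + by left.
  + rewrite ex => -[e|/at_leaf->]; last by left.
    by rewrite e eqxx in ny.
  + rewrite ey sT => -[e|/at_leaf->]; last by left.
    by rewrite e eqxx in nx.
- move=> b u v hb vW vB vu.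
  have [rb ba] := contract_fix hb.
  case: (hosted_contract hb vW) => [vb|[bp va]].
    by apply: hosted_contractS ba _; apply: inv_nbr I _ _ _ rb vb vB vu.
  case: (boolP (v \in hosted rho b)) => vb.
    by apply: hosted_contractS ba _; apply: inv_nbr I _ _ _ rb vb vB vu.
  rewrite bp in vb *; apply: hosted_contractU.
  exact: nbr_leaf va vb vu.
- move=> b q hb sq hq.
  have [rb ba] := contract_fix hb.
  have [sG _] := sgG.
  have hq' x : x \in q -> x != t -> x \notin B b /\
      (x \in hosted rho b \/ b = p /\ x \in hosted rho a).
    move=> xq xt; have := hq x xq xt; rewrite in_setD => /andP[-> h]; split=> //.
    exact: hosted_contract hb h.
  case: (boolP [exists x in hosted rho b, (x \in q) && (x != t)]).
    case/exists_inP => x xb /andP[xq xt].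
    apply: (inv_nopath I rb sq) => y yq yt.
    apply: (internal_closed (x := x) sq.1 _ xq xt _ yq yt).
      move=> u v; rewrite !in_setD => /andP[vB vb] vu uq ut.
      by rewrite (hq' u uq ut).1 (inv_nbr I rb vb vB vu).
    by rewrite in_setD (hq' x xq xt).1.
  rewrite negb_exists_in => /forall_inP h.
  have inner x : x \in q -> x != t ->
      x \in hosted rho a /\ x \notin hosted rho p.
    move=> xq xt; have xb : x \notin hosted rho b.
      by apply/negP => /h; rewrite xq xt.
    case: (hq' x xq xt) => _ [xb'|[bp xa]]; first by rewrite xb' in xb.
    by split=> //; rewrite -bp.
  have [[x [xq xt sx]] [y [yq yt yt']]] := internal_endpoints sq.1.
  have sa : s \in hosted rho a.
    by have [xa xp] := inner x xq xt; apply: nbr_leaf xa xp _; rewrite sG.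
  have ta : t \in hosted rho a.
    by have [ya yp] := inner y yq yt; apply: nbr_leaf ya yp _.
  have [[hp _ _] _] := sq.
  apply: (noshort q); apply: short_restrict sq _ _.
    rewrite in_setD sa andbT; apply/negP => /(subsetP (inv_F I)).
    by rewrite !inE eqxx.
  move=> u uq; rewrite in_setD.
  have := path_induced hp uq; rewrite in_setC => -> /=.
  by case: (eqVneq u t) => [-> //|ut]; case: (inner u uq ut).
(* If [s] comes from the leaf [a], it is also hosted by the root because of [sBr], hence by [p],
   where the old invariant puts it into the bag. *)
- move=> b hb; have [rb ba] := contract_fix hb.
  case/(hosted_contract hb) => [|[bp sa]]; first exact: (inv_s I rb).
  apply: (inv_s I rb); rewrite bp.
  apply: (hosted_leaf (b := r) sa _ _); last by rewrite eq_sym.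
  by apply/hostedP; exists r; rewrite ?(inv_root I).
Qed.

Lemma card_contract :
  #|[set b | contract rho a p b == b]| < #|[set b | rho b == b]|.
Proof.
apply/proper_card/properP; split.
  by apply/subsetP=> b; rewrite !inE => /eqP/contract_fix[-> _].
exists a; rewrite !inE ?rho_a ?eqxx //.
by apply/negP => /eqP/contract_fix[_]; rewrite eqxx.
Qed.

End Contract.

(** The far end of a longest simple path from [r] among the surviving nodes is a leaf: any second
    neighbour would extend the path or close a cycle of [T]. *)
Lemma exists_leaf (rho : A -> A) (F : {set V}) :
  greedy_inv rho F -> 1 < #|[set b | rho b == b]| -> exists a p, leaf rho a p.
Proof.
move=> I.
have [[[sT irT] conT acT] _ _ _] := td.
rewrite (cardsD1 r) inE (inv_root I) eqxx add1n ltnS card_gt0 => /set0Pn[x].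
rewrite !inE => /andP[xr /eqP rx].
pose e : rel A := [rel y z | [&& rho y == y, rho z == z & T y z]].
(* Follow a walk of [T] from [r] to [x]: the first step that leaves the nodes contracted into [r]
   yields, by [inv_edge], a surviving neighbour of [r]. *)
have [y ry] : exists y, e r y.
  case: (boolP [exists y, e r y]) => [/existsP //|]; rewrite negb_exists.
  move=> /forallP h; exfalso.
  suff : rho x = r by rewrite rx => h'; rewrite h' eqxx in xr.
  apply: (connect_ind (P := fun z => rho z = r) _ (conT r x) (inv_root I)) => z1 z2 z12 rz1.
  case: (inv_edge I z12) => [<- //|]; rewrite rz1 => hz.
  by have := h (rho z2); rewrite /e /= hz (inv_root I) (inv_idem I) !eqxx.
pose P k := [exists q : k.-tuple A, path e r q && uniq (r :: q)].
have P1 : P 1.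
  apply/existsP; exists [tuple y]; rewrite /= ry inE !andbT.
  by apply/eqP => ry'; move: ry; rewrite -ry' /e /= irT !andbF.
have exP : exists k, P k by exists 1.
have ubP k : P k -> k <= #|A|.
  case/existsP => q /andP[_ uq]; have := max_card (ssrbool.mem (r :: q)).
  by rewrite (card_uniqP uq) /= size_tuple => /ltnW.
case: (ex_maxnP exP ubP) => k /existsP[q /andP[hq uq]] kmax.
have k1 := kmax 1 P1.
have sq := size_tuple q; move: hq uq sq; case/lastP: (tval q) => [|q' a].
  by move=> _ _ /= e0; rewrite -e0 in k1.
rewrite rcons_path -rcons_cons rcons_uniq size_rcons.
move=> /andP[hq' la] /andP[aq uq'] sq.
set p := last r q' in la.
exists a, p; case/and3P: (la) => rp ra pa.
apply/and3P; split=> //.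
  by apply: contraNneq aq => ->; rewrite inE eqxx.
apply/forallP => b; apply/eqP; apply/idP/eqP => [/andP[ab rb]|->]; last first.
  by rewrite sT pa.
have eab : e a b by rewrite /e /= ra rb ab.
(* By maximality [b] cannot prolong the path, so it lies on it. *)
have bq : b \in r :: q'.
  apply: contraT => bq; suff /kmax : P k.+1 by rewrite ltnn.
  have sz : size (rcons (rcons q' a) b) == k.+1 by rewrite !size_rcons sq.
  suff h : path e r (rcons (rcons q' a) b) && uniq (r :: rcons (rcons q' a) b).
    by apply/existsP; exists (Tuple sz).
  rewrite !rcons_path hq' last_rcons la eab -!rcons_cons !rcons_uniq uq' aq.
  rewrite mem_rcons inE (negPf bq) orbF !andbT.
  by apply: contraTneq ab => ->; rewrite irT.
apply/eqP; apply: contraT => bp; exfalso.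
rewrite /p in bp la {pa rp}; case/splitPl: bq hq' aq uq' bp la => p1 p2 lb.
rewrite cat_path last_cat lb => /andP[_ hp2] aq uq' bp /and3P[_ _ la].
(* A nonempty [p2] gives the cycle through [b], [p2] and [a] at least three nodes, as the acyclicity
   of [T] requires. *)
have p2n : p2 != [::] by apply: contraNneq bp => ->.
have := acT (b :: rcons p2 a).
rewrite /= !rcons_path last_rcons size_rcons ltnS ltnS lt0n size_eq0 p2n ab la.
have -> : path T b p2 by apply: sub_path hp2 => u v /and3P[].
move=> /(_ isT) h; suff /h : (b \notin rcons p2 a) && uniq (rcons p2 a) by [].
move: aq uq'; rewrite -!cat_cons mem_cat cat_uniq negb_or rcons_uniq.
move=> /andP[a1 ->] /and3P[_ /hasPn h2 ->]; rewrite andbT mem_rcons inE negb_or.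
have b1 : b \in r :: p1 by rewrite -lb mem_last.
rewrite andbT; apply/andP; split; first by apply: contraNneq a1 => <-.
by apply/negP => b2; have := h2 b b2; rewrite /= b1.
Qed.

Lemma hosted_root (rho : A -> A) (F : {set V}) (v : V) :
  greedy_inv rho F -> #|[set b | rho b == b]| <= 1 -> v \in hosted rho r.
Proof.
move=> I h1; have [_ /(_ v)[a va] _ _] := td.
apply/hostedP; exists a => //.
apply: (card_le1_eqP h1); rewrite inE ?(inv_idem I) ?(inv_root I) //.
Qed.

(** A sole survivor hosts every vertex, so the absence of short paths at the root is absence in the
    whole graph. The ratio follows because [X :&: Z] is no larger than [X]. *)
Lemma cut_root (rho : A -> A) (F : {set V}) :
  greedy_inv rho F -> #|[set b | rho b == b]| <= 1 ->
  bounded_cut G s t L (cut rho r F) /\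
  forall opt, min_cut_card G s t L opt -> #|cut rho r F| <= width B * opt.
Proof.
move=> I h1; have [I' noshort] := inv_cut I (inv_root I); split.
  split; first exact: inv_F I'.
  move=> p hp; rewrite ltnNge; apply/negP => kp; apply: (noshort p).
  apply: (@short_sub (~: cut rho r F)); last by split.
  by apply/subsetP=> u; rewrite in_setC in_setD (hosted_root u I h1) => ->.
move=> opt [[X hX <-] _]; have [Z [_ /(_ X hX) h]] := inv_opt I'.
by apply: leq_trans h _; rewrite leq_mul2l subset_leq_card ?orbT ?subsetIl.
Qed.

End Greedy.

(** * The program *)

(** On truth values 0 and 1, truncated subtraction yields the connectives; two numbers are equal
    exactly when both truncated differences vanish. *)
Definition eArr (k : nat) (e : expr) : expr := Defs.Mem (eaddr k e).
Definition eNot (e : expr) : expr := Defs.Sub (Lit 1) e.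
Definition eAnd (e1 e2 : expr) : expr := Defs.Sub (Add e1 e2) (Lit 1).
Definition eOr (e1 e2 : expr) : expr := eNot (eAnd (eNot e1) (eNot e2)).
Definition eEq (e1 e2 : expr) : expr :=
  eNot (Add (Defs.Sub e1 e2) (Defs.Sub e2 e1)).

Lemma eval_arr (X : nat) (st : state) (k : nat) (e : expr) :
  regs st 5 = X -> eval st (eArr k e) = view X st k (eval st e).
Proof. by move=> <-; rewrite /view -eval_eaddr. Qed.

Lemma eval_not (st : state) (e : expr) (p : bool) :
  eval st e = p -> eval st (eNot e) = ~~ p.
Proof. by rewrite /= => ->; case: p. Qed.

Lemma eval_and (st : state) (e1 e2 : expr) (p1 p2 : bool) :
  eval st e1 = p1 -> eval st e2 = p2 -> eval st (eAnd e1 e2) = p1 && p2.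
Proof. by rewrite /= => -> ->; case: p1 p2 => -[]. Qed.

Lemma eval_or (st : state) (e1 e2 : expr) (p1 p2 : bool) :
  eval st e1 = p1 -> eval st e2 = p2 -> eval st (eOr e1 e2) = p1 || p2.
Proof. by rewrite /= => -> ->; case: p1 p2 => -[]. Qed.

Lemma eval_eq (st : state) (e1 e2 : expr) (x1 x2 : nat) :
  eval st e1 = x1 -> eval st e2 = x2 -> eval st (eEq e1 e2) = (x1 == x2).
Proof. by rewrite /= => -> ->; case: eqP; lia. Qed.

(** Row offsets are tabulated in arrays 0 to 2, so a matrix entry is reached by additions only. The
    matrix of [G] starts right after the six header words. *)
Definition eG (u v : expr) : expr := Defs.Mem (Add (Lit 6) (Add (eArr 0 u) v)).
Definition eT (a b : expr) : expr := Defs.Mem (Add (Reg 6) (Add (eArr 1 a) b)).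
Definition eB (a v : expr) : expr := Defs.Mem (Add (Reg 7) (Add (eArr 2 a) v)).

Declare Scope prog_scope.
Delimit Scope prog_scope with prog.
Notation "c1 ;; c2" := (PSeq c1 c2)
  (at level 60, right associativity) : prog_scope.
Local Open Scope prog_scope.

(* Registers: 0 = n, 1 = m, 2 = min L n, 3 = s, 4 = t, 5 = first free address,
   6 = address of T, 7 = address of B, 8 = root; the others are scratch, with 9
   holding the current node.
   Arrays: 0, 1, 2 = offsets of the rows of G, T, B; 3 = contraction map,
   4 = cut, 5 = allowed vertices, 6 = reached vertices, 7 = reached vertices
   after the current round. *)

(** With truncated subtraction, [n - (n - L)] is the minimum of [L] and [n]. This loop-free stage is
    separate because it fills registers 0 to 2, the read-only loop bounds of [main_prog]. *)
Definition init_prog : prog :=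
  PSet 0 (Defs.Mem (Lit 0)) ;; PSet 1 (Defs.Mem (Lit 1)) ;;
  PSet 2 (Defs.Sub (Reg 0) (Defs.Sub (Reg 0) (Defs.Mem (Lit 4)))) ;;
  PSet 3 (Defs.Mem (Lit 2)) ;; PSet 4 (Defs.Mem (Lit 3)).

(** The products [n * n], [m * m] and [m * n] are computed by repeated addition. *)
Definition layout_prog : prog :=
  PSet 5 (Lit 6) ;;
  PFor 10 0 (PSet 5 (Add (Reg 5) (Reg 0))) ;; PSet 6 (Reg 5) ;;
  PFor 10 1 (PSet 5 (Add (Reg 5) (Reg 1))) ;; PSet 7 (Reg 5) ;;
  PFor 10 1 (PSet 5 (Add (Reg 5) (Reg 0))).

Definition rows_prog (k bound step : nat) : prog :=
  PSet 15 (Lit 0) ;;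
  PFor 10 bound (PStore k (Reg 10) (Reg 15) ;; PSet 15 (Add (Reg 15) (Reg step))).

Definition root_prog : prog :=
  PFor 10 1 (PIf (eB (Reg 10) (Reg 3)) (PSet 8 (Reg 10)) PSkip).

Definition allowed_prog : prog :=
  PFor 12 0 (PStore 5 (Reg 12) (Lit 0)) ;;
  PFor 11 1 (PFor 12 0 (PStore 5 (Reg 12)
    (eOr (eArr 5 (Reg 12))
         (eAnd (eEq (eArr 3 (Reg 11)) (Reg 9))
               (eAnd (eB (Reg 11) (Reg 12)) (eNot (eArr 4 (Reg 12)))))))).

(** A round accumulates in array 7 while array 6 keeps the old set, so it performs exactly one
    [grow]. *)
Definition reach_prog : prog :=
  PFor 12 0 (PStore 6 (Reg 12)
    (eAnd (eArr 5 (Reg 12)) (eEq (Reg 12) (Reg 3)))) ;;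
  PFor 14 2
    (PFor 12 0 (PStore 7 (Reg 12) (eArr 6 (Reg 12))) ;;
     PFor 13 0 (PFor 12 0 (PStore 7 (Reg 12)
       (eOr (eArr 7 (Reg 12))
            (eAnd (eArr 6 (Reg 13))
                  (eAnd (eG (Reg 13) (Reg 12)) (eArr 5 (Reg 12))))))) ;;
     PFor 12 0 (PStore 6 (Reg 12) (eArr 7 (Reg 12)))).

Definition cut_prog : prog :=
  allowed_prog ;; reach_prog ;;
  PFor 12 0 (PStore 4 (Reg 12)
    (eOr (eArr 4 (Reg 12))
         (eAnd (eArr 6 (Reg 4))
               (eAnd (eNot (eOr (eEq (Reg 12) (Reg 3)) (eEq (Reg 12) (Reg 4))))
                     (eB (Reg 9) (Reg 12)))))).

(** Register 15 counts the surviving neighbours and register 16 keeps the last one, which is the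
    parent when the count is 1. *)
Definition count_prog : prog :=
  PSet 15 (Lit 0) ;;
  PFor 11 1 (PIf (eAnd (eT (Reg 9) (Reg 11)) (eEq (eArr 3 (Reg 11)) (Reg 11)))
    (PSet 15 (Add (Reg 15) (Lit 1)) ;; PSet 16 (Reg 11)) PSkip).

Definition contract_prog : prog :=
  PFor 11 1 (PIf (eEq (eArr 3 (Reg 11)) (Reg 9))
    (PStore 3 (Reg 11) (Reg 16)) PSkip).

Definition node_prog : prog :=
  count_prog ;;
  PIf (eAnd (eNot (eEq (Reg 9) (Reg 8)))
            (eAnd (eEq (eArr 3 (Reg 9)) (Reg 9)) (eEq (Reg 15) (Lit 1))))
    (cut_prog ;; contract_prog) PSkip.

(** Each pass over the nodes contracts a leaf while at least two nodes survive, so [m] passes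
    suffice. The output comes last since it overwrites the input. *)
Definition main_prog : prog :=
  layout_prog ;; rows_prog 0 0 0 ;; rows_prog 1 1 1 ;; rows_prog 2 1 0 ;;
  root_prog ;;
  PFor 10 1 (PStore 3 (Reg 10) (Reg 10)) ;;
  PFor 10 0 (PStore 4 (Reg 10) (Lit 0)) ;;
  PFor 10 1 (PFor 9 1 node_prog) ;;
  PSet 9 (Reg 8) ;; cut_prog ;;
  PFor 12 0 (POut (Reg 12) (eArr 4 (Reg 12))).

Lemma wf_init : wf 0 init_prog. Proof. by []. Qed.

Lemma wf_main : wf 3 main_prog. Proof. by []. Qed.

Lemma den_seq (c1 c2 : prog) (st : state) : den (c1 ;; c2) st = den c2 (den c1 st).
Proof. by []. Qed.

Lemma den_if (e : expr) (c1 c2 : prog) (st : state) :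
  den (PIf e c1 c2) st = if eval st e != 0 then den c1 st else den c2 st.
Proof. by []. Qed.

Lemma sum_loop (st : state) (b d : nat) : b < 3 -> d < 3 ->
  regs (den (PFor 10 b (PSet 5 (Add (Reg 5) (Reg d)))) st) 5 =
  regs st 5 + regs st b * regs st d.
Proof.
move=> b3 d3 /=; set body := fun st' : state => _.
suff H k : regs (iter k body (setr st 10 0)) 5 = regs st 5 + k * regs st d /\
    regs (iter k body (setr st 10 0)) d = regs st d by have [] := H (regs st b).
have d10 : (d == 10) = false by lia.
have d5 : (d == 5) = false by lia.
elim: k => [|k [IH5 IHd]]; first by rewrite addn0 /= /update d10.
rewrite iterS /body /= /update /= IH5 IHd d10 d5; split=> //; lia.
Qed.

Lemma ltn_index (k l : nat) (i : 'I_k) (j : 'I_l) : i * l + j < k * l.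
Proof.
case: i j => i ik [j jl] /=; apply: (@leq_trans (i.+1 * l)); first by lia.
by rewrite leq_mul2r ik orbT.
Qed.

Lemma exists_ltnS (N : nat) (i : 'I_N) (P : pred 'I_N) :
  [exists j : 'I_N, (j < i.+1) && P j] = [exists j : 'I_N, (j < i) && P j] || P i.
Proof.
apply/existsP/orP => [[j /andP[ji Pj]]|[/existsP[j /andP[ji Pj]]|Pi]].
- move: ji; rewrite ltnS leq_eqVlt => /predU1P[/ord_inj <-|ji]; first by right.
  by left; apply/existsP; exists j; rewrite ji.
- by exists j; rewrite Pj ltnS ltnW.
- by exists i; rewrite ltnSn.
Qed.

Lemma set_ltnS (N : nat) (i : 'I_N) (S : {set 'I_N}) :
  [set j in S | j < i.+1] =
  if i \in S then i |: [set j in S | j < i] else [set j in S | j < i].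
Proof.
apply/setP => j; case: ifP => iS; rewrite !inE ltnS leq_eqVlt (inj_eq (@ord_inj N)).
  by case: (eqVneq j i) => [->|_] //; rewrite iS.
by case: (eqVneq j i) => [->|_] //; rewrite iS.
Qed.

(** * Correctness of the program on a fixed instance *)

Section Program.
Variables (n m : nat) (G : rel 'I_n) (T : rel 'I_m) (B : 'I_m -> {set 'I_n}).
Variables (s t : 'I_n) (L : nat).

Let X := 6 + n * n + m * m + m * n.

Record layout (st : state) : Prop := Layout {
  layout_n : regs st 0 = n;
  layout_m : regs st 1 = m;
  layout_L : regs st 2 = minn L n;
  layout_s : regs st 3 = s;
  layout_t : regs st 4 = t;
  layout_X : regs st 5 = X;
  layout_T : regs st 6 = 6 + n * n;
  layout_B : regs st 7 = 6 + n * n + m * m;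
  input_G : forall u v : 'I_n, Defs.mem st (6 + (u * n + v)) = G u v;
  input_T : forall a b : 'I_m, Defs.mem st (6 + n * n + (a * m + b)) = T a b;
  input_B : forall (a : 'I_m) (v : 'I_n),
    Defs.mem st (6 + n * n + m * m + (a * n + v)) = (v \in B a) }.

Record env (st : state) : Prop := Env {
  env_layout : layout st;
  rows_G : forall u : 'I_n, view X st 0 u = u * n;
  rows_T : forall a : 'I_m, view X st 1 a = a * m;
  rows_B : forall a : 'I_m, view X st 2 a = a * n }.

Lemma layout_same (rs ks : seq nat) (st st' : state) :
  same X rs ks st st' -> all (ltn 7) rs -> layout st -> layout st'.
Proof.
move=> [hr _ hm] /allP rs8 [].
have r8 x : x < 8 -> regs st' x = regs st x.
  by move=> x8; apply: hr; apply/negP => /rs8 /=; lia.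
split; rewrite ?r8 // => u v; rewrite hm //.
- by have := ltn_index u v; rewrite /X; lia.
- by have := ltn_index u v; rewrite /X; lia.
- by have := ltn_index u v; rewrite /X; lia.
Qed.

Lemma env_same (rs ks : seq nat) (st st' : state) :
  same X rs ks st st' -> all (ltn 7) rs -> all (ltn 2) ks -> env st -> env st'.
Proof.
move=> hs rs8 /allP ks3 [hl hG hT hB].
have v3 k i : k < 3 -> view X st' k i = view X st k i.
  case: hs => _ hv _ k3; apply: hv; first exact: leq_trans k3 _.
  by apply/negP => /ks3 /=; lia.
by split=> [|u|u|u]; rewrite ?v3 //; apply: layout_same hs rs8 hl.
Qed.

Lemma env_setr (st : state) (r v : nat) : 7 < r -> env st -> env (setr st r v).
Proof.
move=> r7; apply: (env_same (rs := [:: r]) (ks := [::])); rewrite /= ?r7 //.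
by split=> // x; rewrite inE /= /update => /negPf->.
Qed.

Lemma env_X (st : state) : env st -> regs st 5 = X.
Proof. by case=> /layout_X. Qed.

Lemma eval_reg_same (rs ks : seq nat) (st st' : state) (r x : nat) :
  same X rs ks st st' -> r \notin rs -> eval st (Reg r) = x -> eval st' (Reg r) = x.
Proof. by case=> h _ _ hr /= <-; apply: h. Qed.

Lemma eval_s (st : state) : env st -> eval st (Reg 3) = s.
Proof. by case=> /layout_s. Qed.

Lemma eval_t (st : state) : env st -> eval st (Reg 4) = t.
Proof. by case=> /layout_t. Qed.

Lemma eval_eG (st : state) (eu ev : expr) (u v : 'I_n) :
  env st -> eval st eu = u -> eval st ev = v -> eval st (eG eu ev) = G u v.
Proof.
move=> E hu hv; rewrite -(input_G (env_layout E)) -(rows_G E) -hu -hv.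
by rewrite -(eval_arr _ _ (env_X E)).
Qed.

Lemma eval_eT (st : state) (ea eb : expr) (a b : 'I_m) :
  env st -> eval st ea = a -> eval st eb = b -> eval st (eT ea eb) = T a b.
Proof.
move=> E ha hb; rewrite -(input_T (env_layout E)) -(rows_T E) -ha -hb.
by rewrite -(eval_arr _ _ (env_X E)) -(layout_T (env_layout E)).
Qed.

Lemma eval_eB (st : state) (ea ev : expr) (a : 'I_m) (v : 'I_n) :
  env st -> eval st ea = a -> eval st ev = v ->
  eval st (eB ea ev) = (v \in B a).
Proof.
move=> E ha hv; rewrite -(input_B (env_layout E)) -(rows_B E) -ha -hv.
by rewrite -(eval_arr _ _ (env_X E)) -(layout_B (env_layout E)).
Qed.

Definition is_set (st : state) (k : nat) (S : {set 'I_n}) : Prop :=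
  forall v : 'I_n, view X st k v = (v \in S).

Definition is_map (st : state) (rho : 'I_m -> 'I_m) : Prop :=
  forall b : 'I_m, view X st 3 b = rho b.

Lemma eval_set (st : state) (k : nat) (S : {set 'I_n}) (e : expr) (v : 'I_n) :
  env st -> is_set st k S -> eval st e = v -> eval st (eArr k e) = (v \in S).
Proof. by move=> E hS hv; rewrite (eval_arr _ _ (env_X E)) hv hS. Qed.

Lemma eval_map (st : state) (rho : 'I_m -> 'I_m) (e : expr) (b : 'I_m) :
  env st -> is_map st rho -> eval st e = b -> eval st (eArr 3 e) = rho b.
Proof. by move=> E hS hb; rewrite (eval_arr _ _ (env_X E)) hb hS. Qed.

Lemma is_set_same (rs ks : seq nat) (st st' : state) (k : nat) (S : {set 'I_n}) :
  same X rs ks st st' -> (k < 8) && (k \notin ks) -> is_set st k S -> is_set st' k S.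
Proof. by move=> [_ hv _] /andP[k8 kk] hS v; rewrite hv. Qed.

Lemma is_map_same (rs ks : seq nat) (st st' : state) (rho : 'I_m -> 'I_m) :
  same X rs ks st st' -> 3 \notin ks -> is_map st rho -> is_map st' rho.
Proof. by move=> [_ hv _] kk hS v; rewrite hv. Qed.

Lemma env_den (c : prog) (st : state) :
  tame c -> all (ltn 7) (assigned c) -> all (ltn 2) (stored c) ->
  env st -> env (den c st).
Proof. by move=> tc a7 s2 E; apply: env_same (same_den tc (env_X E)) _ _ E. Qed.

(** For updates in place: [e] may read the old membership bit of the cell being written, whereas
    [fill_loop] assumes nothing about the old array. *)
Lemma set_loop (k : nat) (e : expr) (st : state) (S S' : {set 'I_n}) :
  (2 < k) && (k < 8) -> env st -> is_set st k S ->
  (forall (v : 'I_n) (st' : state), same X [:: 12] [:: k] st st' -> env st' ->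
     eval st' (Reg 12) = v -> eval st' (eArr k (Reg 12)) = (v \in S) ->
     eval st' e = (v \in S')) ->
  is_set (den (PFor 12 0 (PStore k (Reg 12) e)) st) k S'.
Proof.
move=> /andP[k2 k8] E hS H.
apply: (for_store _ (env_X E) (layout_n (env_layout E))) => [|v st' hs hv hk] //.
have E' : env st' by apply: env_same hs _ _ E; rewrite //= k2.
by apply: (H _ _ hs E' hv _); rewrite (eval_arr _ _ (env_X E')) hv hk hS.
Qed.

Lemma fill_loop (k : nat) (e : expr) (st : state) (S : {set 'I_n}) :
  (2 < k) && (k < 8) -> env st ->
  (forall (v : 'I_n) (st' : state), same X [:: 12] [:: k] st st' -> env st' ->
     eval st' (Reg 12) = v -> eval st' e = (v \in S)) ->
  is_set (den (PFor 12 0 (PStore k (Reg 12) e)) st) k S.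
Proof.
move=> /andP[k2 k8] E H.
apply: (for_store _ (env_X E) (layout_n (env_layout E))) => [|v st' hs hv _] //.
by apply: (H _ _ hs _ hv); apply: env_same hs _ _ E; rewrite //= k2.
Qed.

(** * Processing a single node *)

Section Node.
Variables (rho : 'I_m -> 'I_m) (F : {set 'I_n}) (a : 'I_m).

Record node_env (st : state) : Prop := NodeEnv {
  node_is_env : env st;
  node_map : is_map st rho;
  node_cut : is_set st 4 F;
  node_reg : regs st 9 = a }.

Lemma eval_node (st : state) : node_env st -> eval st (Reg 9) = a.
Proof. by case. Qed.

Lemma node_env_same (rs ks : seq nat) (st st' : state) :
  same X rs ks st st' -> all (ltn 9) rs -> all (ltn 4) ks ->
  node_env st -> node_env st'.
Proof.
move=> hs /allP hr /allP hk [E hrho hF ha]; split.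
- apply: env_same hs _ _ E; apply/allP => x; first by move/hr => /=; lia.
  by move/hk => /=; lia.
- by apply: is_map_same hs _ hrho; apply/negP => /hk.
- by apply: is_set_same hs _ hF; rewrite /=; apply/negP => /hk.
- by case: hs => -> //; apply/negP => /hr.
Qed.

Lemma node_env_den (c : prog) (st : state) :
  tame c -> all (ltn 9) (assigned c) -> all (ltn 4) (stored c) ->
  node_env st -> node_env (den c st).
Proof.
move=> tc a9 s4 E; apply: (node_env_same (same_den tc _) _ _ E) => //.
exact: env_X (node_is_env E).
Qed.

Lemma allowed_progP (st : state) :
  node_env st -> is_set (den allowed_prog st) 5 (hosted B rho a :\: F).
Proof.
move=> E; rewrite /allowed_prog den_seq.
set c1 := PFor 12 0 (PStore 5 _ (Lit 0)); set c2 := PFor 11 1 _.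
have h1 : is_set (den c1 st) 5 set0.
  by apply: fill_loop (node_is_env E) _ => // v st' _ _ _; rewrite inE.
have E1 : node_env (den c1 st) by apply: node_env_den.
(* Loop invariant: the contribution of the nodes with index below [k]. *)
pose S k := [set v | (v \notin F) &&
  [exists b : 'I_m, (b < k) && ((rho b == a) && (v \in B b))]].
suff h : is_set (den c2 (den c1 st)) 5 (S m).
  move=> v; rewrite h !inE; congr (nat_of_bool (_ && _)).
  by apply: eq_existsb => b; rewrite ltn_ord.
have E0 := node_is_env E1.
apply: (for_rule (I := fun k st' => is_set st' 5 (S k)) _ _ (env_X E0)
         (layout_m (env_layout E0))) => //.
  move=> v; rewrite [LHS]h1 !inE; case: existsP => [[b]|]; rewrite ?andbF //.
move=> b st' hs' hb hS; have E' : node_env st' by apply: node_env_same hs' _ _ E1.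
apply: (set_loop (k := 5) _ (node_is_env E') hS) => // v st2 hs2 _ hv h5.
have E2 : node_env st2 by apply: node_env_same hs2 _ _ E'.
have b2 : eval st2 (Reg 11) = b by apply: eval_reg_same hs2 _ hb.
rewrite (eval_or h5 (eval_and (eval_eq (eval_map (node_is_env E2) (node_map E2) b2)
  (eval_node E2)) (eval_and (eval_eB (node_is_env E2) b2 hv)
  (eval_not (eval_set (node_is_env E2) (node_cut E2) hv))))).
rewrite !inE exists_ltnS andb_orr; congr (nat_of_bool (_ || _)).
by rewrite (inj_eq (@ord_inj m)) andbA [RHS]andbC.
Qed.

Lemma reach_progP (st : state) (A : {set 'I_n}) :
  env st -> is_set st 5 A -> is_set (den reach_prog st) 6 (reach G s A (minn L n)).
Proof.
move=> E hA; rewrite /reach_prog den_seq.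
set c1 := PFor 12 0 (PStore 6 _ (eAnd _ _)); set c2 := PFor 14 2 _.
have set_den c k S st' : tame c && (k < 8) && (k \notin stored c) -> env st' ->
    is_set st' k S -> is_set (den c st') k S.
  move=> /andP[/andP[tc k8] kc] E'; apply: (is_set_same (same_den tc (env_X E'))).
  by rewrite k8.
have E1 : env (den c1 st) by apply: env_den.
have A1 : is_set (den c1 st) 5 A by apply: set_den.
have R1 : is_set (den c1 st) 6 (A :&: [set s]).
  apply: (fill_loop _ E) => // u st' hs E' hu.
  have A' : is_set st' 5 A by apply: is_set_same hs _ hA.
  rewrite !inE (eval_and (eval_set E' A' hu) (eval_eq hu (eval_s E'))).
  by rewrite (inj_eq (@ord_inj n)).
apply: (for_rule (I := fun k st' => is_set st' 6 (reach G s A k)) _ _ (env_X E1)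
         (layout_L (env_layout E1))) => //.
move=> i st' hs' hi hR; have E' : env st' by apply: env_same hs' _ _ E1.
have A' : is_set st' 5 A by apply: is_set_same hs' _ A1.
rewrite !den_seq; set R := reach G s A i in hR *.
set d1 := PFor 12 0 (PStore 7 _ (eArr 6 _)); set d2 := PFor 13 0 _.
have E2 : env (den d1 st') by apply: env_den.
have A2 : is_set (den d1 st') 5 A by apply: set_den.
have R2 : is_set (den d1 st') 6 R by apply: set_den.
have N2 : is_set (den d1 st') 7 R.
  apply: (fill_loop _ E') => // u st2 hs Eu hu.
  have Ru : is_set st2 6 R by apply: is_set_same hs _ hR.
  exact: eval_set Eu Ru hu.
have E3 : env (den d2 (den d1 st')) by apply: env_den.
have N3 : is_set (den d2 (den d1 st')) 7 (grow G A R).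
  (* The old set together with the neighbours of its members of index below [k]. *)
  pose S k := [set v | (v \in R) ||
    (v \in A) && [exists u : 'I_n, (u < k) && ((u \in R) && G u v)]].
  suff h : is_set (den d2 (den d1 st')) 7 (S n).
    move=> v; rewrite h !inE; congr (nat_of_bool (_ || (_ && _))).
    by apply: eq_existsb => u; rewrite ltn_ord.
  apply: (for_rule (I := fun k st' => is_set st' 7 (S k)) _ _ (env_X E2)
           (layout_n (env_layout E2))) => //.
    move=> v; rewrite [LHS]N2 !inE.
    by case: existsP => [[u]|]; rewrite ?andbF ?orbF.
  move=> u st2 hs2 hu hS; have Eu : env st2 by apply: env_same hs2 _ _ E2.
  have Ru : is_set st2 6 R by apply: is_set_same hs2 _ R2.
  have Au : is_set st2 5 A by apply: is_set_same hs2 _ A2.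
  apply: (set_loop (k := 7) _ Eu hS) => // v st3 hs3 Ev hv h7.
  have Rv : is_set st3 6 R by apply: is_set_same hs3 _ Ru.
  have Av : is_set st3 5 A by apply: is_set_same hs3 _ Au.
  have uv : eval st3 (Reg 13) = u by apply: eval_reg_same hs3 _ hu.
  rewrite (eval_or h7 (eval_and (eval_set Ev Rv uv)
    (eval_and (eval_eG Ev uv hv) (eval_set Ev Av hv)))).
  rewrite !inE exists_ltnS andb_orr orbA; congr (nat_of_bool (_ || _)).
  by rewrite andbA [RHS]andbC.
suff : is_set (den (PFor 12 0 (PStore 6 (Reg 12) (eArr 7 (Reg 12))))
  (den d2 (den d1 st'))) 6 (grow G A R) by [].
apply: (fill_loop _ E3) => // u st2 hs Eu hu.
have Nu : is_set st2 7 (grow G A R) by apply: is_set_same hs _ N3.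
exact: eval_set Eu Nu hu.
Qed.

Lemma cut_progP (st : state) :
  node_env st -> is_set (den cut_prog st) 4 (cut G B s t L rho a F).
Proof.
move=> E; rewrite /cut_prog !den_seq.
set st1 := den allowed_prog st; set st2 := den reach_prog st1.
have E1 : node_env st1 by apply: node_env_den.
have E2 : node_env st2 by apply: node_env_den.
have h1 : is_set st1 5 (hosted B rho a :\: F) by apply: allowed_progP.
have h2 := reach_progP (node_is_env E1) h1.
apply: (set_loop (k := 4) _ (node_is_env E2) (node_cut E2)) => // v st3 hs3 Ev hv h4.
have Rv := is_set_same (k := 6) hs3 isT h2.
have av : eval st3 (Reg 9) = a by apply: eval_reg_same hs3 _ (eval_node E2).
have [ls lt] := (eval_s Ev, eval_t Ev).
rewrite (eval_or h4 (eval_and (eval_set Ev Rv lt) (eval_and (eval_not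
  (eval_or (eval_eq hv ls) (eval_eq hv lt))) (eval_eB Ev av hv)))).
rewrite /cut card_ord !(inj_eq (@ord_inj n)); case: ifP => _ /=; last by rewrite orbF.
by rewrite in_setU in_setD in_set2.
Qed.

(** Overwriting the entry of [a] itself does not disturb later tests: they compare with register 9,
    and each reads only its own entry. *)
Lemma contract_progP (st : state) (p : 'I_m) :
  env st -> is_map st rho -> eval st (Reg 9) = a -> eval st (Reg 16) = p ->
  is_map (den contract_prog st) (contract rho a p).
Proof.
move=> E0 hrho h9 hp.
apply: (for_map _ _ _ (env_X E0) (layout_m (env_layout E0))) => //.
move=> b st' hs hb hv j.
have E' : env st' by apply: env_same hs _ _ E0.
have ha : eval st' (Reg 9) = a by apply: eval_reg_same hs _ h9.
have hp' : eval st' (Reg 16) = p by apply: eval_reg_same hs _ hp.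
have hm : eval st' (eArr 3 (Reg 11)) = rho b.
  by rewrite (eval_arr _ _ (env_X E')) hb hv hrho.
rewrite /contract.
rewrite den_if (eval_eq hm ha) (inj_eq (@ord_inj m)) eqb0 negbK; case: eqP => _.
  by rewrite view_store ?(env_X E') // eqxx hb hp'.
by case: eqP => // ->; rewrite hv hrho.
Qed.

Lemma count_progP (st : state) :
  node_env st -> let N := [set b | T a b && (rho b == b)] in
  regs (den count_prog st) 15 = #|N| /\
  (N != set0 -> exists2 p, p \in N & regs (den count_prog st) 16 = p).
Proof.
move=> E N; rewrite /count_prog den_seq; set st1 := den (PSet _ _) st.
have E1 : node_env st1 by apply: node_env_den.
pose I k st' := regs st' 15 = #|[set b in N | b < k]| /\
  ([set b in N | b < k] != set0 -> exists2 p, p \in N & regs st' 16 = p).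
have NE : [set b in N | b < m] = N by apply/setP => b; rewrite !inE ltn_ord andbT.
suff : I m (den (PFor 11 1
    (PIf (eAnd (eT (Reg 9) (Reg 11)) (eEq (eArr 3 (Reg 11)) (Reg 11)))
    (PSet 15 (Add (Reg 15) (Lit 1)) ;; PSet 16 (Reg 11)) PSkip)) st1) by rewrite /I NE.
have E0 := node_is_env E1.
apply: (for_rule _ _ (env_X E0) (layout_m (env_layout E0))) => //.
  suff e : [set b in N | b < 0] = set0 by rewrite /I e cards0 eqxx.
  by apply/setP => b; rewrite !inE andbF.
move=> b st' hs hb [h1 h2]; have E' : node_env st' by apply: node_env_same hs _ _ E1.
have hc : eval st' (eAnd (eT (Reg 9) (Reg 11)) (eEq (eArr 3 (Reg 11)) (Reg 11))) =
    (b \in N).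
  have hm := eval_map (node_is_env E') (node_map E') hb.
  rewrite inE (eval_and (eval_eT (node_is_env E') (eval_node E') hb) (eval_eq hm hb)).
  by rewrite (inj_eq (@ord_inj m)).
rewrite /I set_ltnS; set c := PIf _ _ _.
have -> : den c st' = if b \in N
    then den (PSet 15 (Add (Reg 15) (Lit 1)) ;; PSet 16 (Reg 11)) st' else st'.
  by rewrite /c den_if hc eqb0 negbK.
case: ifP => bN; last by [].
split; last by move=> _; exists b.
by rewrite cardsU1 inE ltnn andbF /= /update /= h1 addnC.
Qed.

Lemma node_progP (st : state) (r : 'I_m) :
  node_env st -> eval st (Reg 8) = r ->
  (exists p, [/\ leaf T r rho a p,
       is_map (den node_prog st) (contract rho a p)
     & is_set (den node_prog st) 4 (cut G B s t L rho a F)]) \/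
  [/\ forall p, ~~ leaf T r rho a p, is_map (den node_prog st) rho
    & is_set (den node_prog st) 4 F].
Proof.
move=> E hr; have [h15 h16] := count_progP E.
set N := [set b | _] in h15 h16.
(* Being a leaf with parent [p] means that the set of surviving neighbours is the singleton of [p],
   which a counter and one witness detect. *)
have leafE p : leaf T r rho a p = [&& a != r, rho a == a & N == [set p]].
  rewrite /leaf; congr [&& _, _ & _]; apply/forallP/eqP => [h|h b].
    by apply/setP => b; rewrite !inE (eqP (h b)).
  by have /setP/(_ b) := h; rewrite !inE => ->.
rewrite /node_prog den_seq; set st1 := den count_prog st in h15 h16 *.
have E1 : node_env st1 by apply: node_env_den.
have hr1 : eval st1 (Reg 8) = r by rewrite -hr; apply: regs_den.
have ha := eval_node E1.
have h15' : eval st1 (Reg 15) = #|N| by [].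
have one : eval st1 (Lit 1) = 1 by [].
rewrite den_if (eval_and (eval_not (eval_eq ha hr1)) (eval_and (eval_eq (eval_map
  (node_is_env E1) (node_map E1) ha) ha) (eval_eq h15' one))) eqb0 negbK.
rewrite !(inj_eq (@ord_inj m)); case: ifP => [/and3P[ar ra /cards1P[p Np]]|h].
  left; exists p; rewrite den_seq leafE ar ra Np eqxx.
  have hp : eval st1 (Reg 16) = p.
    case: h16 => [|q]; first by rewrite Np; apply/set0Pn; exists p; rewrite inE.
    by rewrite Np inE => /eqP->.
  set st2 := den cut_prog st1.
  have hs2 : same X (assigned cut_prog) (stored cut_prog) st1 st2.
    by apply: same_den; rewrite ?(env_X (node_is_env E1)).
  have hp2 : eval st2 (Reg 16) = p by apply: eval_reg_same hs2 _ hp.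
  have E2 : env st2 by apply: env_den; last exact: node_is_env E1.
  have m2 : is_map st2 rho by apply: is_map_same hs2 _ (node_map E1).
  have a2 : eval st2 (Reg 9) = a by apply: eval_reg_same hs2 _ ha.
  split=> //; first exact: contract_progP.
  apply: (is_set_same (same_den _ (env_X E2))) => //.
  exact: cut_progP.
right; split; [|exact: node_map E1|exact: node_cut E1].
move=> p; rewrite leafE; apply: contraFN h => /and3P[-> -> /eqP->].
by rewrite cards1.
Qed.

End Node.

(** Raw stores are not [tame], so the loop is followed by hand. It stays below [n <= X], hence never
    damages array 4, from which it reads. *)
Lemma out_progP (st : state) (F : {set 'I_n}) :
  env st -> is_set st 4 F ->
  forall v : 'I_n,
    Defs.mem (den (PFor 12 0 (POut (Reg 12) (eArr 4 (Reg 12)))) st) v = (v \in F).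
Proof.
move=> E hF; rewrite /den -/den (layout_n (env_layout E)).
set body := fun st' : state => _.
suff H k : k <= n -> let st' := iter k body (setr st 12 0) in
    [/\ regs st' 12 = k, regs st' 5 = X, is_set st' 4 F
      & forall v : 'I_n, v < k -> Defs.mem st' v = (v \in F)].
  by move=> v; have [_ _ _ ->] := H n (leqnn n).
elim: k => [|k IHk] kn.
  by split=> //; rewrite /update /=; exact: env_X.
have [h12 h5 h4 hv] := IHk (ltnW kn).
cbv zeta; rewrite iterS; set st' := iter k body _ in h12 h5 h4 hv *.
have nX : n <= X by rewrite /X; case: (n) => // n'; rewrite mulSn; lia.
have h12' : eval st' (Reg 12) = Ordinal kn by [].
have he : eval st' (eArr 4 (Reg 12)) = (Ordinal kn \in F).
  by rewrite (eval_arr _ _ h5) h12' h4.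
rewrite /body he h12'; split.
- by rewrite /= /update /= h12 addn1.
- by rewrite /= /update.
- move=> v; rewrite -[RHS](h4 v) /view /= /update; case: eqP => // e; exfalso; lia.
move=> v; rewrite ltnS leq_eqVlt /= /update; case: eqP => [e _|_ /= vk]; last exact: hv.
by congr (nat_of_bool (_ \in F)); apply: ord_inj.
Qed.

(** * Repeated passes and the final cut at the root *)

Section Correct.
Variable r : 'I_m.
Hypotheses (sgG : simple_graph G) (neq_st : s != t) (nadj_st : ~~ G s t).
Hypotheses (td : tree_decomposition G T B) (sBr : s \in B r).

Definition live (rho : 'I_m -> 'I_m) : {set 'I_m} := [set b | rho b == b].

Definition good (k : nat) (rho : 'I_m -> 'I_m) (F : {set 'I_n}) (st : state) : Prop :=
  [/\ env st, eval st (Reg 8) = r, is_map st rho, is_set st 4 F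
    & greedy_inv G T B s t L r rho F /\ #|live rho| <= maxn 1 (m - k)].

Lemma pass_progP (st : state) (k : nat) (rho : 'I_m -> 'I_m) (F : {set 'I_n}) :
  k < m -> good k rho F st ->
  exists rho' F', good k.+1 rho' F' (den (PFor 9 1 node_prog) st).
Proof.
move=> km gst; have [E hr _ _ _] := gst.
(* Either this pass has already contracted a node, or some leaf has index at least [j]. A node found
   not to be a leaf leaves the map unchanged, so the awaited leaf still lies ahead. *)
pose I j st' := exists rho F, good k rho F st' /\
  (#|live rho| <= maxn 1 (m - k.+1) \/
   exists a p : 'I_m, j <= a /\ leaf T r rho a p).
suff [rho' [F' [[E' hr' hm' hF' [I' _]] h]]] : I m (den (PFor 9 1 node_prog) st).
  exists rho', F'; split=> //; split=> //.
  by case: h => [//|[a [p [ma _]]]]; have := ltn_ord a; rewrite ltnNge ma.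
apply: (for_rule _ _ (env_X E) (layout_m (env_layout E))) => //.
  exists rho, F; split.
    case: gst => E0 hr0 hm0 hF0 Ih; split=> //.
    exact: env_setr.
  have [_ _ _ _ [Ii hl]] := gst.
  case: (leqP #|live rho| 1) => [h1|h1]; first by left; rewrite leq_max h1.
  right; have [a [p lf]] := exists_leaf td Ii h1; by exists a, p.
move=> a st' hs ha [rho1 [F1 [[E1 hr1 hm1 hF1 [I1 hl1]] h1]]].
have N1 : node_env rho1 F1 a st' by split.
have E2 : env (den node_prog st') by apply: env_den.
have E3 : env (setr (den node_prog st') 9 a.+1).
  exact: env_setr.
have hr2 : eval (setr (den node_prog st') 9 a.+1) (Reg 8) = r.
  by rewrite -hr1; apply: (regs_den (c := node_prog)).
case: (node_progP N1 hr1) => [[p [lf m2 F2]]|[nolf m2 F2]].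
  have ra : rho1 a = a by case/and3P: (lf) => _ /eqP.
  have [I2 noshort] := inv_cut sgG neq_st nadj_st sBr I1 ra.
  exists (contract rho1 a p), (cut G B s t L rho1 a F1).
  have I3 := inv_contract sgG neq_st nadj_st td sBr I2 lf noshort.
  have hc : #|live (contract rho1 a p)| < #|live rho1| := card_contract td lf.
  split; last by left; lia.
  by split=> //; split=> //; lia.
exists rho1, F1; split; first by split.
case: h1 => [|[b [p [ab lf]]]]; first by left.
right; exists b, p; split=> //; rewrite ltn_neqAle ab andbT.
by apply/negP => /eqP/ord_inj e; have := nolf p; rewrite e lf.
Qed.

Lemma passes_progP (st : state) :
  env st -> eval st (Reg 8) = r -> is_map st id -> is_set st 4 set0 ->
  exists rho F, good m rho F (den (PFor 10 1 (PFor 9 1 node_prog)) st).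
Proof.
move=> E hr hm hF.
apply: (for_rule (I := fun k st' => exists rho F, good k rho F st')
          _ _ (env_X E) (layout_m (env_layout E))) => //.
  exists id, set0; split=> //; first exact: env_setr.
  split; first exact: inv_init.
  by rewrite subn0 leq_max -[X in _ || (_ <= X)]card_ord max_card orbT.
move=> k st' hs hk [rho1 [F1 g1]].
have [rho2 [F2 [E2 hr2 hm2 hF2 [I2 l2]]]] := pass_progP (ltn_ord k) g1.
exists rho2, F2; split=> //; exact: env_setr.
Qed.

Lemma greedy_progP (st : state) :
  env st -> eval st (Reg 8) = r -> is_map st id -> is_set st 4 set0 ->
  exists2 F,
    is_set (den (PFor 10 1 (PFor 9 1 node_prog) ;;
                 PSet 9 (Reg 8) ;; cut_prog) st) 4 F &
    bounded_cut G s t L F /\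
    forall opt, min_cut_card G s t L opt -> #|F| <= width B * opt.
Proof.
move=> E hr hm hF; have [rho [F [E1 hr1 m1 F1 [I1]]]] := passes_progP E hr hm hF.
rewrite subnn => l1.
exists (cut G B s t L rho r F); last exact: (cut_root sgG neq_st nadj_st td sBr I1 l1).
rewrite !den_seq; set st1 := den (PFor 10 _ _) st in E1 hr1 m1 F1 *.
apply: cut_progP; split=> //; exact: env_setr.
Qed.

End Correct.

Lemma layout_progP (st : state) :
  [/\ regs st 0 = n, regs st 1 = m, regs st 2 = minn L n,
      regs st 3 = s & regs st 4 = t] ->
  (forall u v : 'I_n, Defs.mem st (6 + (u * n + v)) = G u v) ->
  (forall a b : 'I_m, Defs.mem st (6 + n * n + (a * m + b)) = T a b) ->
  (forall (a : 'I_m) (v : 'I_n),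
     Defs.mem st (6 + n * n + m * m + (a * n + v)) = (v \in B a)) ->
  layout (den layout_prog st).
Proof.
move=> [h0 h1 h2 h3 h4] hG hT hB.
have r5 x : x < 5 -> regs (den layout_prog st) x = regs st x.
  by move=> x5; apply: regs_den; rewrite /= !inE; lia.
have [e5 e6 e7] : [/\ regs (den layout_prog st) 5 = X,
    regs (den layout_prog st) 6 = 6 + n * n
  & regs (den layout_prog st) 7 = 6 + n * n + m * m].
  rewrite /layout_prog !den_seq.
  set st1 := den (PSet 5 _) st; set st2 := den _ st1; set st3 := den (PSet 6 _) st2.
  set st4 := den (PFor 10 1 _) st3; set st5 := den (PSet 7 _) st4; set st6 := den _ st5.
  have r c st' x : x \notin assigned c -> regs (den c st') x = regs st' x.
    exact: regs_den.
  have e2 : regs st2 5 = 6 + n * n by rewrite sum_loop // (r _ _ 0) // h0.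
  have e4 : regs st4 5 = 6 + n * n + m * m.
    by rewrite sum_loop // !(r _ _ 1) // h1 (r _ _ 5) // e2.
  split.
  - by rewrite sum_loop // !(r _ _ 0) // !(r _ _ 1) // h0 h1 (r _ _ 5) // e4.
  - by rewrite /st6 r // /st5 r // /st4 r // -e2.
  - by rewrite /st6 r // -e4.
by split=> // [| | | | |u v|u v|u v]; rewrite ?r5 // mem_den.
Qed.

Lemma rows_progP (k b d N : nat) (st : state) :
  (k < 8) && (b < 3) && (d < 3) -> regs st 5 = X -> regs st b = N ->
  forall i : 'I_N, view X (den (rows_prog k b d) st) k i = i * regs st d.
Proof.
move=> /andP[/andP[k8 b3] d3] hX hb; rewrite /rows_prog den_seq.
set st1 := den (PSet 15 _) st.
have lt3 x y : x < 3 -> 2 < y -> (x == y) = false by lia.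
have hX1 : regs st1 5 = X by [].
have hb1 : regs st1 b = N by rewrite -hb /st1 /= /update lt3.
pose I j st' := regs st' 15 = j * regs st d /\
  forall i : 'I_N, i < j -> view X st' k i = i * regs st d.
set c := PFor _ _ _; suff [_ h] : I N (den c st1) by move=> i; exact: h.
apply: (for_rule _ _ hX1 hb1) => //.
- by rewrite /tame /= k8.
- by rewrite /= eq_sym lt3 // inE lt3.
move=> i st' hs hi [h15 hI]; have hX' : regs st' 5 = X by rewrite -hX1; case: hs => ->.
have hd : regs st' d = regs st d.
  by case: hs => -> //; rewrite ?inE ?lt3 // /st1 /= /update lt3.
rewrite den_seq; split.
  by rewrite /= /update /= h15 hd mulSnr.
move=> j; rewrite ltnS leq_eqVlt.
suff -> : view X (setr (den (PSet 15 (Add (Reg 15) (Reg d)))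
    (den (PStore k (Reg 10) (Reg 15)) st')) 10 i.+1) k j =
    view X (den (PStore k (Reg 10) (Reg 15)) st') k j.
  rewrite view_store // eqxx hi; case: eqP => [-> _|_ ji] //=.
  exact: hI.
by [].
Qed.

(** Every node whose bag contains [s] serves as a root; the loop keeps the last one, and the
    decomposition guarantees that one exists. *)
Lemma root_progP (st : state) :
  tree_decomposition G T B -> env st ->
  exists2 r, s \in B r & eval (den root_prog st) (Reg 8) = r.
Proof.
move=> td E.
pose I k st' := forall a : 'I_m, a < k -> s \in B a ->
  exists2 r, s \in B r & eval st' (Reg 8) = r.
have [_ /(_ s)[a sa] _ _] := td.
suff /(_ a (ltn_ord a) sa) : I m (den root_prog st) by [].
apply: (for_rule _ _ (env_X E) (layout_m (env_layout E))) => //.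
move=> b st' hs hb hI; have E' : env st' by apply: env_same hs _ _ E.
have hc := eval_eB E' hb (eval_s E').
rewrite den_if hc eqb0 negbK => c; rewrite ltnS leq_eqVlt.
case: ifP => [sb _ _|sb /predU1P[/ord_inj ->|cb] sc]; last exact: hI cb sc.
  by exists b; rewrite //= /update.
by rewrite sc in sb.
Qed.

Lemma main_progP (st : state) :
  simple_graph G -> s != t -> ~~ G s t -> tree_decomposition G T B ->
  [/\ regs st 0 = n, regs st 1 = m, regs st 2 = minn L n,
      regs st 3 = s & regs st 4 = t] ->
  (forall u v : 'I_n, Defs.mem st (6 + (u * n + v)) = G u v) ->
  (forall a b : 'I_m, Defs.mem st (6 + n * n + (a * m + b)) = T a b) ->
  (forall (a : 'I_m) (v : 'I_n),
     Defs.mem st (6 + n * n + m * m + (a * n + v)) = (v \in B a)) ->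
  exists F : {set 'I_n},
  [/\ forall v : 'I_n, Defs.mem (den main_prog st) v = (v \in F),
      bounded_cut G s t L F
    & forall opt, min_cut_card G s t L opt -> #|F| <= width B * opt].
Proof.
move=> sgG neq_st nadj_st td hr hG hT hB.
have lay := layout_progP hr hG hT hB.
rewrite /main_prog 4!den_seq.
set st0 := den layout_prog st in lay *.
set c0 := rows_prog 0 0 0; set c1 := rows_prog 1 1 1; set c2 := rows_prog 2 1 0.
have hX := layout_X lay.
have lay_den c st' :
    tame c -> all (ltn 7) (assigned c) -> layout st' -> layout (den c st').
  by move=> tc a7 l; apply: (layout_same (same_den tc (layout_X l)) a7 l).
have view_den c st' k i : tame c -> regs st' 5 = X -> k \notin stored c -> k < 8 ->
    view X (den c st') k i = view X st' k i.
  by move=> tc h5 kc k8; case: (same_den tc h5) => _ ->.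
have l1 : layout (den c0 st0) by apply: lay_den.
have l2 : layout (den c1 (den c0 st0)) by apply: lay_den.
have l3 : layout (den c2 (den c1 (den c0 st0))) by apply: lay_den.
have E : env (den c2 (den c1 (den c0 st0))).
  split=> // i.
  - rewrite (view_den c2) ?(layout_X l2) // (view_den c1) ?(layout_X l1) //.
    by rewrite (@rows_progP 0 0 0 n) // (layout_n lay).
  - rewrite (view_den c2) ?(layout_X l2) //.
    by rewrite (@rows_progP 1 1 1 m) ?(layout_X l1) // (layout_m l1).
  by rewrite (@rows_progP 2 1 0 m) ?(layout_X l2) ?(layout_m l2) // (layout_n l2).
set st3 := den c2 _ in l3 E *.
rewrite 3!den_seq; have [r sBr h8] := root_progP td E.
set d1 := PFor 10 1 (PStore 3 _ _); set d2 := PFor 10 0 _.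
have E4 : env (den root_prog st3) by apply: env_den.
have E5 : env (den d1 (den root_prog st3)) by apply: env_den.
have E6 : env (den d2 (den d1 (den root_prog st3))) by apply: env_den.
have h86 : eval (den d2 (den d1 (den root_prog st3))) (Reg 8) = r.
  have r8 c st' : 8 \notin assigned c -> eval (den c st') (Reg 8) = eval st' (Reg 8).
    exact: regs_den.
  by rewrite -h8 (r8 d2) // (r8 d1).
have m5 : is_map (den d1 (den root_prog st3)) id.
  move=> b; apply: (@for_store X 3 10 1 (Reg 10) _ m (fun b => b)) => //.
  - exact: env_X.
  - exact: layout_m (env_layout E4).
have m6 : is_map (den d2 (den d1 (den root_prog st3))) id.
  by apply: (is_map_same (same_den _ (env_X E5)) _ m5).
have F6 : is_set (den d2 (den d1 (den root_prog st3))) 4 set0.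
  move=> v; rewrite inE; apply: (@for_store X 4 10 0 (Lit 0) _ n (fun=> 0)) => //.
  - exact: env_X.
  - exact: layout_n (env_layout E5).
set st6 := den d2 _ in E6 h86 m6 F6 *.
have [F hF [cutF optF]] := greedy_progP sgG neq_st nadj_st td sBr E6 h86 m6 F6.
exists F; split=> //; rewrite 3!den_seq; rewrite 2!den_seq in hF.
by apply: out_progP => //; apply: env_den => //; apply: env_den => //; apply: env_den.
Qed.

End Program.

(** * Encoding of the input *)

Lemma nth_flatten_uniform (ss : seq (seq nat)) (k i j : nat) :
  all (fun x => size x == k) ss -> i < size ss -> j < k ->
  nth 0 (flatten ss) (i * k + j) = nth 0 (nth [::] ss i) j.
Proof.
elim: ss i => [|x ss IH] [|i] //= /andP[/eqP sx hs] si jk; rewrite nth_cat sx.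
  by rewrite jk.
by rewrite mulSn -addnA ltnNge leq_addr addKn IH.
Qed.

Lemma size_encode_set (n : nat) (S : {set 'I_n}) : size (encode_set S) = n.
Proof. by rewrite size_map size_enum_ord. Qed.

Lemma nth_encode_set (n : nat) (S : {set 'I_n}) (v : 'I_n) :
  nth 0 (encode_set S) v = (v \in S).
Proof. by rewrite (nth_map v) ?size_enum_ord // nth_ord_enum. Qed.

Lemma size_encode_rows (k n : nat) (f : 'I_k -> {set 'I_n}) :
  size (flatten [seq encode_set (f i) | i <- enum 'I_k]) = k * n.
Proof.
rewrite -[in RHS](size_enum_ord k); elim: (enum 'I_k) => //= i r IH.
by rewrite size_cat size_encode_set IH mulSn.
Qed.

Lemma nth_encode_rows (k n : nat) (f : 'I_k -> {set 'I_n}) (i : 'I_k) (v : 'I_n) :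
  nth 0 (flatten [seq encode_set (f i) | i <- enum 'I_k]) (i * n + v) = (v \in f i).
Proof.
rewrite nth_flatten_uniform //; last by rewrite size_map size_enum_ord.
  by rewrite (nth_map i) ?size_enum_ord // nth_ord_enum nth_encode_set.
by apply/allP => x /mapP[j _ ->]; rewrite size_encode_set.
Qed.

Lemma nth_catD (s1 s2 : seq nat) (k i : nat) :
  size s1 = k -> nth 0 (s1 ++ s2) (k + i) = nth 0 s2 i.
Proof. by move=> <-; rewrite nth_cat ltnNge leq_addr addKn. Qed.

Section Encoding.
Variables (n m : nat) (G : rel 'I_n) (T : rel 'I_m) (B : 'I_m -> {set 'I_n}).
Variables (s t : 'I_n) (L : nat) (r : 'I_m).

Let input := encode_instance G s t L T r B.

Lemma size_input : size input = 6 + n * n + m * m + m * n.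
Proof. by rewrite !size_cat !size_encode_rows /= !addnA. Qed.

Lemma nth_input_G (u v : 'I_n) : nth 0 input (6 + (u * n + v)) = G u v.
Proof.
rewrite /input /encode_instance /encode_rel nth_catD // nth_cat size_encode_rows ltn_index.
by rewrite nth_encode_rows inE.
Qed.

Lemma nth_input_T (a b : 'I_m) :
  nth 0 input (6 + n * n + (a * m + b)) = T a b.
Proof.
rewrite /input /encode_instance /encode_rel -addnA nth_catD // nth_catD ?size_encode_rows //.
by rewrite nth_cat size_encode_rows ltn_index nth_encode_rows inE.
Qed.

Lemma nth_input_B (a : 'I_m) (v : 'I_n) :
  nth 0 input (6 + n * n + m * m + (a * n + v)) = (v \in B a).
Proof.
rewrite /input /encode_instance /encode_rel -!addnA nth_catD // nth_catD ?size_encode_rows //.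
by rewrite nth_catD ?size_encode_rows // nth_encode_rows.
Qed.

End Encoding.

(** Every word, even 0, counts for at least one bit. *)
Lemma size_bit_size (input : seq nat) : size input <= bit_size input.
Proof. by rewrite -sum1_size; apply: leq_sum. Qed.

Theorem theorem6 :
  exists (P : cmd) (c d : nat),
  forall (n : nat) (G : rel 'I_n) (s t : 'I_n) (L : nat)
    (m : nat) (T : rel 'I_m) (root : 'I_m) (B : 'I_m -> {set 'I_n}) (tau : nat),
  simple_graph G -> s != t -> ~~ G s t -> 0 < L ->
  tree_decomposition G T B -> width B = tau ->
  exists (F : {set 'I_n}) (time : nat),
  [/\ computes P (encode_instance G s t L T root B) (encode_set F) time,
      time <= c * bit_size (encode_instance G s t L T root B) ^ d,
      bounded_cut G s t L F
    & forall opt : nat, min_cut_card G s t L opt -> #|F| <= tau * opt].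
Proof.
have [C [d hC]] := cost_poly (init_prog ;; main_prog).
(* The factor [2 ^ d] turns the bound in [N.+1] into one in [N], as [N.+1 <= 2 * N] for a nonempty
   input. *)
exists (compile (init_prog ;; main_prog)), (C * 2 ^ d), d.
move=> n G s t L m T root B tau sgG neq_st nadj_st _ td <-.
set input := encode_instance _ _ _ _ _ _ _; set N := bit_size input.
have inputN : size input <= N := size_bit_size input.
pose st := den init_prog (init input).
have [nN mN] : n <= N /\ m <= N.
  split; apply: leq_trans inputN; rewrite size_input.
    by case: (n) => // n'; rewrite mulSn; lia.
  by case: (m) => // m'; rewrite [m'.+1 * m'.+1]mulSn; lia.
have hr : [/\ regs st 0 = n, regs st 1 = m, regs st 2 = minn L n,
      regs st 3 = s & regs st 4 = t].
  by split=> //; rewrite /st /= /update /=; lia.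
have [F [outF cutF optF]] := main_progP sgG neq_st nadj_st td hr
  (nth_input_G G T B s t L root) (nth_input_T G T B s t L root)
  (nth_input_B G T B s t L root).
have [|k1 ex1 le1] := exec_compile (N := N) (st := init input) wf_init; first by [].
(* Registers 0 to 2 hold [n], [m] and [minn L n], all at most [N]; the cap at [n] keeps the time
   polynomial when [L] is exponential in its bit length. *)
have [|k2 ex2 le2] := exec_compile (N := N) (st := st) wf_main.
  case: hr => h0 h1 h2 _ _ [|[|[|x]]] // _; rewrite ?h0 ?h1 ?h2 //.
  exact: leq_trans (geq_minr _ _) nN.
exists F, (k1 + k2); split=> //.
- exists (den main_prog st); first exact: exec_Seq ex1 ex2.
  move=> i; rewrite size_encode_set => iN; rewrite -[i]/(nat_of_ord (Ordinal iN)).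
  by rewrite outF nth_encode_set.
apply: (leq_trans (leq_add le1 le2)); apply: (leq_trans (hC N)).
rewrite -mulnA -expnMn leq_mul2l; apply/orP; right.
have N0 : 0 < N by apply: leq_trans inputN; rewrite size_input.
by case: (d) => // d'; rewrite leq_exp2r //; lia.
Qed.
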